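(* Let $m>2$. The space $\mathfrak F=\{\Phi_{ab}\in\otimes^2\mathfrak V^*:\Phi_{ab}=\Phi_{(ab)},\ \Phi_c{}^c=0\}$ of tracefree symmetric $2$-tensors admits a filtration $$\{0\}=:\mathfrak F^2\subset\mathfrak F^1\subset\mathfrak F^0\subset\mathfrak F^{-1}:=\mathfrak F$$ of $\mathfrak p$-modules $$\mathfrak F^i=\{\Phi_{ab}\in\mathfrak F:{}^{\mathfrak F}_\xi\Pi^0_{i-1}(\Phi)=0\},\quad i=0,1,$$ where ${}^{\mathfrak F}_\xi\Pi^0_{-1}(\Phi):=\xi^{aA}\xi^{bB}\Phi_{ab}$ and ${}^{\mathfrak F}_\xi\Pi^0_0(\Phi):=\xi^{aA}\Phi_{ab}$. Further, each $\mathfrak p$-module $\mathfrak F_i^0:=\mathfrak F^i/\mathfrak F^{i+1}$ ($i=-1,0,1$) is an irreducible $\mathfrak p$-module, isomorphic to the following $\mathfrak g_0$-module: $\mathfrak F_0^0\cong\mathfrak V_{\frac12}\circledcirc\mathfrak V_{-\frac12}$, of dimension $m^2-1$; $\mathfrak F_{\pm1}^0\cong\mathfrak V_{\pm\frac12}\circledcirc\mathfrak V_{\pm\frac12}$, each of dimension $\frac12m(m+1)$.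
   Context: Let $\mathfrak V$ be a $2m$-dimensional oriented complex vector space ($m>2$) with non-degenerate symmetric bilinear form $g_{ab}$, used to raise and lower indices. Round/square brackets denote normalised (skew-)symmetrisation. $\mathfrak S^\pm$ are the chiral spinor spaces; elements of $\mathfrak S^+$ have primed upper indices, elements of $\mathfrak S^-$ unprimed upper indices. Clifford multiplication is given by $\gamma_{aA'}{}^B$, $\gamma_{aA}{}^{B'}$ with $\gamma_{(a|A'}{}^{C}\gamma_{|b)C}{}^{B'}=-g_{ab}\delta_{A'}^{B'}$, $\gamma_{(a|A}{}^{C'}\gamma_{|b)C'}{}^{B}=-g_{ab}\delta_A^B$. Fix a pure spinor $\xi^{A'}\in\mathfrak S^+$, i.e. a non-zero spinor for which the kernel of $\xi_a{}^A:=\xi^{B'}\gamma_{aB'}{}^A:\mathfrak V\to\mathfrak S^-$ has dimension $m$ (it is then totally null). Identify $\mathfrak g:=\mathfrak{so}(2m,\mathbb C)$ with $\wedge^2\mathfrak V^*$. $\mathfrak p:=\{\phi_{ab}\in\mathfrak g:\xi^{aA}\xi^{bB}\phi_{ab}=0\}$ is the stabiliser of the line spanned by $\xi^{A'}$. Put $\mathfrak V_{\frac12}:=\ker(\xi_a{}^A:\mathfrak V\to\mathfrak S^-)$ and choose a totally null complement $\mathfrak V_{-\frac12}$ of it in $\mathfrak V$; this induces a grading $\mathfrak g=\mathfrak g_{-1}\oplus\mathfrak g_0\oplus\mathfrak g_1$ with $\mathfrak g_{\pm1}\cong\wedge^2\mathfrak V_{\pm\frac12}$, $\mathfrak g_0\cong\mathfrak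 V_{-\frac12}\otimes\mathfrak V_{\frac12}\cong\mathfrak{gl}(m,\mathbb C)$, $\mathfrak p=\mathfrak g_0\oplus\mathfrak g_1$. ''Isomorphic to the $\mathfrak g_0$-module'' means isomorphic as a $\mathfrak g_0$-module. $\mathfrak M\circledcirc\mathfrak M'$ denotes the Cartan product, the unique irreducible component of highest dimension in $\mathfrak M\otimes\mathfrak M'$. *)

(* Defs.v *)
From HB Require Import structures.
From mathcomp Require Import all_boot all_order all_algebra.
From mathcomp Require Import complex reals ring.

Set Implicit Arguments.
Unset Strict Implicit.
Unset Printing Implicit Defensive.

Import GRing.Theory.
Local Open Scope ring_scope.

(* Quotient vector spaces: the carrier is the library's quotient of additive
   groups, here equipped with its scaling and with a finite dimension. *)
Section Quotient.
Variables (F : fieldType) (M : vectType F) (U : {vspace M}).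

Definition quotv : Type := Quotient.quot (pred_of_vspace U).
HB.instance Definition _ := GRing.Zmodule.on quotv.

Definition qclass (v : M) : quotv :=
  \pi_(Quotient.quot (pred_of_vspace U))%qT v.
Definition qrepr (c : quotv) : M :=
  repr (c : Quotient.quot (pred_of_vspace U)).

Lemma qreprK : cancel qrepr qclass.
Proof. by move=> c; rewrite /qclass /qrepr reprK. Qed.

Lemma qclass_eq (v w : M) : (qclass v = qclass w) <-> (v - w \in U).
Proof.
have E := Quotient.idealrBE (pred_of_vspace U) v w.
by split=> [/eqP h|h]; [rewrite E | apply/eqP; rewrite -E].
Qed.

Lemma qreprP v : qrepr (qclass v) - v \in U.
Proof. by apply/qclass_eq; rewrite qreprK. Qed.

Fact qclass_zmod : zmod_morphism qclass.
Proof. exact: (raddfB \pi_(Quotient.quot (pred_of_vspace U))%qT). Qed.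
HB.instance Definition _ := GRing.isZmodMorphism.Build M quotv qclass qclass_zmod.

Definition qscale (k : F) (c : quotv) : quotv := qclass (k *: qrepr c).

Lemma qscaleE k v : qscale k (qclass v) = qclass (k *: v).
Proof. by apply/qclass_eq; rewrite -scalerBr memvZ ?qreprP. Qed.

Fact qscaleA a b c : qscale a (qscale b c) = qscale (a * b) c.
Proof. by rewrite -(qreprK c) !qscaleE scalerA. Qed.
Fact qscale1 : left_id 1 qscale.
Proof. by move=> c; rewrite -(qreprK c) qscaleE scale1r. Qed.
Fact qscaleDr : right_distributive qscale +%R.
Proof.
move=> k c d; rewrite -(qreprK c) -(qreprK d) -raddfD !qscaleE.
by rewrite scalerDr raddfD.
Qed.
Fact qscaleDl c : {morph qscale^~ c : a b / a + b}.
Proof. by move=> a b; rewrite -(qreprK c) !qscaleE scalerDl raddfD. Qed.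

HB.instance Definition _ := GRing.Zmodule_isLmodule.Build F quotv
  qscaleA qscale1 qscaleDr qscaleDl.

Fact qclass_scalable : scalable qclass.
Proof. by move=> k v; rewrite -qscaleE. Qed.
HB.instance Definition _ :=
  GRing.isScalable.Build F M quotv *:%R qclass qclass_scalable.

Definition qcoord (c : quotv) : 'rV[F]_(\dim U^C) :=
  \row_i coord (vbasis U^C) i (daddv_pi U^C U (qrepr c)).
Definition qvec (r : 'rV[F]_(\dim U^C)) : quotv :=
  qclass (\sum_i r 0 i *: (vbasis U^C)`_i).

Lemma capvCU : (U^C :&: U = 0)%VS.
Proof. by rewrite capvC capv_compl. Qed.

Lemma daddv_piCU (u : M) : u \in U -> daddv_pi U^C U u = 0.
Proof.
move=> uU; have /(_ u) := daddv_pi_add capvCU.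
rewrite addvC addv_complf memvf => /(_ isT).
rewrite (daddv_pi_id _ uU) ?capv_compl // => /eqP.
by rewrite -subr_eq0 addrK => /eqP.
Qed.

Lemma qcoordE v :
  qcoord (qclass v) = \row_i coord (vbasis U^C) i (daddv_pi U^C U v).
Proof.
apply/rowP=> i; rewrite !mxE; congr (coord _ i _).
by rewrite -[qrepr _](subrK v) linearD /= daddv_piCU ?add0r ?qreprP.
Qed.

Fact qcoord_linear : linear qcoord.
Proof.
move=> k c d; rewrite -(qreprK c) -(qreprK d) -linearP !qcoordE.
by apply/rowP=> i; rewrite !mxE !linearP.
Qed.

Lemma qcoordK : cancel qcoord qvec.
Proof.
move=> c; rewrite -(qreprK c) qcoordE /qvec.
under eq_bigr do rewrite mxE.
rewrite -(coord_vbasis (memv_pi _ _ _)); apply/qclass_eq.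
have /(_ (qrepr c)) := daddv_pi_add capvCU.
rewrite addvC addv_complf memvf => /(_ isT) {2}<-.
by rewrite opprD addrA subrr sub0r memvN memv_pi.
Qed.

Lemma qvecK : cancel qvec qcoord.
Proof.
move=> r; rewrite /qvec qcoordE; apply/rowP=> i; rewrite mxE.
rewrite daddv_pi_id ?capvCU //; first exact/coord_sum_free/basis_free/vbasisP.
by apply: memv_suml => j _; rewrite memvZ // vbasis_mem // mem_nth ?size_tuple.
Qed.

Fact quotv_axiom : Vector.axiom (\dim U^C) quotv.
Proof. by exists qcoord; [exact: qcoord_linear | exists qvec; [exact: qcoordK | exact: qvecK]]. Qed.

HB.instance Definition _ := Lmodule_hasFinDim.Build F quotv quotv_axiom.
End Quotient.

Section Duality.
Variable F : fieldType.

Lemma linfunE (A B : vectType F) (f : A -> B) :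
  linear f -> forall v, linfun f v = f v.
Proof.
move=> fP; pose fL := GRing.isSemilinear.Build F _ _ _ f (GRing.semilinear_linear fP).
by pose f' : {linear _ -> _} := HB.pack f fL; exact: (lfunE f').
Qed.

Definition dual (A : vectType F) : vectType F := 'Hom(A, F^o).

Definition dualmap (A B : vectType F) (f : 'Hom(A, B)) : 'Hom(dual B, dual A) :=
  linfun (fun a : dual B => (a \o f)%VF : dual A).

Definition bidual (A : vectType F) : 'Hom(A, dual (dual A)) :=
  linfun (fun v => linfun (fun a : dual A => a v : F^o) : dual (dual A)).

Lemma dual_linP (A : vectType F) k (a b : dual A) v :
  (k *: a + b) v = k * a v + b v.
Proof. by rewrite add_lfunE scale_lfunE. Qed.

Lemma dualmapE (A B : vectType F) (f : 'Hom(A, B)) a v : dualmap f a v = a (f v).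
Proof.
rewrite linfunE ?comp_lfunE // => k b c.
by apply/lfunP=> w; rewrite dual_linP !comp_lfunE dual_linP.
Qed.

Lemma bidualE (A : vectType F) (v : A) (a : dual A) : bidual A v a = a v.
Proof.
have E (w : A) b : (linfun (fun a : dual A => a w : F^o) : dual (dual A)) b = b w.
  by rewrite linfunE // => k c d; rewrite dual_linP.
rewrite linfunE ?E // => k u w.
by apply/lfunP=> b; rewrite dual_linP !E linearP.
Qed.
End Duality.

(* The tensor product of A and B is realised as the linear maps from the dual
   of A to B; [tensor v w] is the elementary tensor. *)
Section TensorProduct.
Variables (F : fieldType) (A B : vectType F).

Definition tensprod : vectType F := 'Hom(dual A, B).

Definition tensor (v : A) (w : B) : tensprod :=
  linfun (fun a : dual A => (a v : F) *: w).

Definition tensv (X : {vspace A}) (Y : {vspace B}) : {vspace tensprod} :=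
  <<[seq tensor v w | v <- vbasis X, w <- vbasis Y]>>%VS.

(* f (x) 1 + 1 (x) h *)
Definition tens_act (f : 'End(A)) (h : 'End(B)) : 'End(tensprod) :=
  linfun (fun t : tensprod => ((h \o t) + (t \o dualmap f))%VF : tensprod).

Lemma tensorE v w a : tensor v w a = (a v : F) *: w.
Proof. by rewrite linfunE // => k b c; rewrite dual_linP scalerDl scalerA. Qed.

Lemma tensprod_linP k (t1 t2 : tensprod) a :
  (k *: t1 + t2) a = k *: t1 a + t2 a.
Proof. by rewrite add_lfunE scale_lfunE. Qed.

Lemma tens_actE f h (t : tensprod) : tens_act f h t = ((h \o t) + (t \o dualmap f))%VF.
Proof.
have E (t' : tensprod) a :
    ((h \o t') + (t' \o dualmap f))%VF a = h (t' a) + t' (dualmap f a).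
  by rewrite add_lfunE !comp_lfunE.
rewrite linfunE // => k t1 t2; apply/lfunP=> a.
by rewrite tensprod_linP !E !tensprod_linP linearP scalerDr addrACA.
Qed.

Lemma tens_act_tensor f h v w :
  tens_act f h (tensor v w) = tensor (f v) w + tensor v (h w).
Proof.
apply/lfunP=> a; rewrite tens_actE !add_lfunE !comp_lfunE !tensorE.
by rewrite dualmapE linearZ addrC.
Qed.
End TensorProduct.

(* Modules over a set [a] of elements of a Lie algebra: the elements act on an
   ambient space through [rho], and a module is an invariant subspace. *)
Section Modules.
Variables (F : fieldType) (L : Type) (a : {pred L}).

Definition submodule (M : vectType F) (rho : L -> 'End(M)) (X : {vspace M}) :=
  {in a, forall x, (rho x @: X <= X)%VS}.

Definition irreducible (M : vectType F) (rho : L -> 'End(M)) (X : {vspace M}) :=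
  [/\ X <> 0%VS, submodule rho X
    & forall Y : {vspace M}, (Y <= X)%VS -> submodule rho Y ->
        Y = 0%VS \/ Y = X].

Definition isomorphic (M N : vectType F)
    (rhoM : L -> 'End(M)) (X : {vspace M})
    (rhoN : L -> 'End(N)) (Y : {vspace N}) :=
  exists f : 'Hom(M, N),
    [/\ {in X &, injective f}, (f @: X = Y)%VS
      & {in a, forall x, {in X, forall v, f (rhoM x v) = rhoN x (f v)}}].

(* Z is the unique irreducible component of highest dimension in X (x) Y. *)
Definition cartan_product (M N : vectType F)
    (rhoM : L -> 'End(M)) (X : {vspace M})
    (rhoN : L -> 'End(N)) (Y : {vspace N})
    (Z : {vspace tensprod M N}) :=
  let component W :=
    irreducible (fun x => tens_act (rhoM x) (rhoN x)) W
    /\ (W <= tensv X Y)%VS in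
  component Z /\ forall W, component W -> W <> Z -> (\dim W < \dim Z)%N.

(* The subspace X / U of M / U *)
Definition subquo (M : vectType F) (X U : {vspace M}) : {vspace quotv U} :=
  (linfun (@qclass F M U) @: X)%VS.

(* The endomorphism of M / U induced by f; meaningful only if f preserves U
   (see [quo_actE]). *)
Definition quo_act (M : vectType F) (U : {vspace M}) (f : 'End(M)) :
    'End(quotv U) :=
  linfun (fun c : quotv U => qclass U (f (qrepr c))).
End Modules.

Lemma quo_actE (F : fieldType) (M : vectType F) (U : {vspace M}) (f : 'End(M)) v :
  (f @: U <= U)%VS -> quo_act U f (qclass U v) = qclass U (f v).
Proof.
move=> fU.
have E w : qclass U (f (qrepr (qclass U w))) = qclass U (f w).
  by apply/qclass_eq; rewrite -linearB (subvP fU) // memv_img // qreprP.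
rewrite /quo_act linfunE ?E // => k c d.
by rewrite -(qreprK c) -(qreprK d) -linearP /= !E !linearP.
Qed.

(* A covariant 2-tensor Phi_ab is a linear map from V to its dual, with
   Phi u v = Phi_ab u^a v^b. *)
Definition tensor2 (F : fieldType) (V : vectType F) : vectType F := 'Hom(V, dual V).

Section Tensors.
Variables (F : fieldType) (V : vectType F).
Implicit Types (Phi Psi : tensor2 V) (u v : V).

Lemma tensor2P Phi Psi : (forall u v, Phi u v = Psi u v) <-> Phi = Psi.
Proof. by split=> [e|-> //]; apply/lfunP=> u; apply/lfunP=> v. Qed.

Lemma tensor2_linP k Phi Psi u v :
  (k *: Phi + Psi) u v = k * Phi u v + Psi u v.
Proof. by rewrite [X in fun_of_lfun X v]add_lfunE scale_lfunE dual_linP. Qed.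

Lemma tensor2N Phi u v : (- Phi) u v = - Phi u v.
Proof. by rewrite -[- Phi]addr0 -scaleN1r tensor2_linP mulN1r !lfunE addr0. Qed.

Definition transp : 'End(tensor2 V) :=
  linfun (fun Phi => (dualmap Phi \o bidual V)%VF : tensor2 V).

Lemma transpE Phi u v : transp Phi u v = Phi v u.
Proof.
have E Psi x y : (dualmap Psi \o bidual V)%VF x y = Psi y x.
  by rewrite comp_lfunE dualmapE bidualE.
rewrite linfunE ?E // => k P Q; apply/tensor2P => x y.
by rewrite tensor2_linP !E tensor2_linP.
Qed.

Definition symm2 : {vspace tensor2 V} := lker (transp - \1)%VF.
Definition skew2 : {vspace tensor2 V} := lker (transp + \1)%VF.

Lemma symm2P Phi : reflect (forall u v, Phi u v = Phi v u) (Phi \in symm2).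
Proof.
rewrite memv_ker add_lfunE opp_lfunE id_lfunE subr_eq0.
apply: (iffP eqP) => [e u v|e]; first by rewrite -{1}e transpE.
by apply/tensor2P=> u v; rewrite transpE.
Qed.

Lemma skew2P Phi : reflect (forall u v, Phi u v = - Phi v u) (Phi \in skew2).
Proof.
rewrite memv_ker add_lfunE id_lfunE addr_eq0.
apply: (iffP eqP) => [e u v|e].
  by rewrite -(transpE Phi u v) e tensor2N opprK.
by apply/tensor2P=> u v; rewrite transpE tensor2N e.
Qed.

(* The action on 2-tensors of an endomorphism of V:
   (u, v) |-> - Phi (f u) v - Phi u (f v). *)
Definition tensor2_act (f : 'End(V)) : 'End(tensor2 V) :=
  linfun (fun Phi : tensor2 V => - ((Phi \o f) + (dualmap f \o Phi))%VF : tensor2 V).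

Lemma tensor2_actE f Phi u v :
  tensor2_act f Phi u v = - Phi (f u) v - Phi u (f v).
Proof.
have E Psi x y : (- ((Psi \o f) + (dualmap f \o Psi))%VF : tensor2 V) x y
    = - Psi (f x) y - Psi x (f y).
  rewrite tensor2N -[X in X + _]scale1r tensor2_linP mul1r.
  by rewrite !comp_lfunE dualmapE opprD.
rewrite linfunE ?E // => k P Q; apply/tensor2P => x y.
by rewrite tensor2_linP !E !tensor2_linP; ring.
Qed.

Variable g : tensor2 V.

Definition nondegenerate_symmetric := (g \in symm2) && (lker g == 0%VS).

(* Raising an index: the inverse of v |-> g v when g is nondegenerate *)
Definition sharp : 'Hom(dual V, V) := (g^-1)%VF.

(* Phi_c^c *)
Definition tr2 Phi : F^o :=
  \tr (passmx.mxof (vbasis {:V}) (vbasis {:V}) (sharp \o Phi)%VF).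

Fact tr2_linear : linear tr2.
Proof.
move=> k P Q; rewrite /tr2 comp_lfunDr -comp_lfunZr.
by rewrite passmx.mxof_linear mxtraceD mxtraceZ.
Qed.

Definition tracefree_symm2 : {vspace tensor2 V} :=
  (symm2 :&: lker (linfun tr2))%VS.

Lemma tracefree_symm2P Phi :
  reflect (Phi \in symm2 /\ tr2 Phi = 0) (Phi \in tracefree_symm2).
Proof.
rewrite memv_cap [X in _ && X]memv_ker (linfunE tr2_linear).
by apply: (iffP andP) => -[? /eqP ?]; split=> //; apply/eqP.
Qed.

(* so(V, g) is identified with the skew 2-tensors, phi_ab acting on V by
   v^a |-> phi^a_b v^b. *)
Definition so_act (phi : tensor2 V) : 'End(V) := (sharp \o transp phi)%VF.

Definition totally_null (W : {vspace V}) := {in W &, forall u v, g u v = 0}.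

Definition orthonormal_frame n (e : n.-tuple V) :=
  forall i j : 'I_n, g e`_i e`_j = (i == j)%:R.
End Tensors.

Section Spinors.
Variables (F : fieldType) (V Sp Sm : vectType F).
Variables (g : tensor2 V) (gp : 'Hom(V, 'Hom(Sp, Sm))) (gm : 'Hom(V, 'Hom(Sm, Sp))).

(* The Clifford product of a frame e_0, ..., e_(2m-1), acting on Sp *)
Definition frame_act m (e : (2 * m).-tuple V) (s : Sp) : Sp :=
  foldr (fun (i : 'I_m) t => gm e`_(2 * i) (gp e`_(2 * i).+1 t)) s (enum 'I_m).

(* Sp and Sm are the chiral spinor spaces S^+ and S^- of V, oriented by the
   orthonormal frame e.  The last condition tells S^+ from S^-: the Clifford
   product of the oriented frame has square (-1)^m, and S^+ is its eigenspace
   for the eigenvalue i^m, where iota is i. *)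
Definition chiral_spinors (iota : F) m (e : (2 * m).-tuple V) :=
  [/\ \dim {:Sp} = (2 ^ (m - 1))%N /\ \dim {:Sm} = (2 ^ (m - 1))%N,
      forall u v s, 2^-1 *: (gm v (gp u s) + gm u (gp v s)) = - (g u v : F) *: s,
      forall u v s, 2^-1 *: (gp v (gm u s) + gp u (gm v s)) = - (g u v : F) *: s
    & forall s, frame_act e s = iota ^+ m *: s].

Variable xi : Sp.

(* xi_a^A, as a map from V to Sm *)
Definition xi_low : 'Hom(V, Sm) := linfun (fun v => gp v xi).

Lemma xi_lowE v : xi_low v = gp v xi.
Proof.
rewrite linfunE // => k u w.
by rewrite linearP add_lfunE scale_lfunE.
Qed.

(* xi^aA, as a map from the dual of Sm to V *)
Definition xi_up : 'Hom(dual Sm, V) := (sharp g \o dualmap xi_low)%VF.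

Definition pure_spinor m := xi <> 0 /\ \dim (lker xi_low) = m.

(* xi^aA xi^bB Phi_ab, as a bilinear form on the dual of Sm *)
Definition Pi_m1 (Phi : tensor2 V) : tensor2 (dual Sm) :=
  (dualmap xi_up \o (Phi \o xi_up))%VF.

(* xi^aA Phi_ab *)
Definition Pi_0 (Phi : tensor2 V) : 'Hom(dual Sm, dual V) := (Phi \o xi_up)%VF.

Lemma Pi_m1E Phi al be : Pi_m1 Phi al be = Phi (xi_up al) (xi_up be).
Proof. by rewrite /Pi_m1 2!comp_lfunE dualmapE. Qed.

Lemma Pi_0E Phi al v : Pi_0 Phi al v = Phi (xi_up al) v.
Proof. by rewrite comp_lfunE. Qed.

Fact Pi_m1_linear : linear Pi_m1.
Proof.
by move=> k P Q; apply/tensor2P=> al be; rewrite tensor2_linP !Pi_m1E tensor2_linP.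
Qed.

Fact Pi_0_linear : linear Pi_0.
Proof. by move=> k P Q; rewrite /Pi_0 comp_lfunDl -comp_lfunZl. Qed.

Definition parabolic : {vspace tensor2 V} :=
  (skew2 V :&: lker (linfun Pi_m1))%VS.

(* V_(1/2) *)
Definition V_half : {vspace V} := lker xi_low.

(* The grading of so(V, g) induced by that of V; [V_deg Vm j] has degree j/2. *)
Definition V_deg (Vm : {vspace V}) (j : int) : {vspace V} :=
  if j == 1 then V_half else if j == -1 then Vm else 0%VS.

Definition g_deg (Vm : {vspace V}) (k : int) : {pred tensor2 V} :=
  [pred phi in skew2 V |
    (so_act g phi @: V_deg Vm 1%R <= V_deg Vm (1 + 2 * k)%R)%VS &&
    (so_act g phi @: V_deg Vm (-1)%R <= V_deg Vm (-1 + 2 * k)%R)%VS].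

Definition filtration (i : int) : {vspace tensor2 V} :=
  if i <= -1 then tracefree_symm2 g
  else if i == 0 then (tracefree_symm2 g :&: lker (linfun Pi_m1))%VS
  else if i == 1 then (tracefree_symm2 g :&: lker (linfun Pi_0))%VS
  else 0%VS.

Lemma filtration0P Phi :
  reflect (Phi \in tracefree_symm2 g /\ Pi_m1 Phi = 0) (Phi \in filtration 0).
Proof.
have -> : (Phi \in filtration 0) = (Phi \in tracefree_symm2 g) && (Pi_m1 Phi == 0).
  by rewrite [LHS]memv_cap [X in _ && X]memv_ker (linfunE Pi_m1_linear).
by apply: (iffP andP) => -[? /eqP ?]; split=> //; apply/eqP.
Qed.

Lemma filtration1P Phi :
  reflect (Phi \in tracefree_symm2 g /\ Pi_0 Phi = 0) (Phi \in filtration 1).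
Proof.
have -> : (Phi \in filtration 1) = (Phi \in tracefree_symm2 g) && (Pi_0 Phi == 0).
  by rewrite [LHS]memv_cap [X in _ && X]memv_ker (linfunE Pi_0_linear).
by apply: (iffP andP) => -[? /eqP ?]; split=> //; apply/eqP.
Qed.

Definition filt_act (phi : tensor2 V) : 'End(tensor2 V) :=
  tensor2_act (so_act g phi).

Definition graded (i : int) : {vspace quotv (filtration (i + 1))} :=
  subquo (filtration i) (filtration (i + 1)).

Definition graded_act (i : int) (phi : tensor2 V) :
    'End(quotv (filtration (i + 1))) :=
  quo_act (filtration (i + 1)) (filt_act phi).
End Spinors.

(* Main.v *)
Require Import Defs.
From mathcomp Require Import all_boot all_order all_algebra.
From mathcomp Require Import complex reals ring.

Set Implicit Arguments.
Unset Strict Implicit.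
Unset Printing Implicit Defensive.

Import GRing.Theory.
Local Open Scope ring_scope.

(* The image of [xi_up] is V_(1/2), so F^0 and F^1 consist of the forms Phi
   vanishing on V_(1/2) x V_(1/2) and on V_(1/2) x V.  Composing Phi with the
   projections of V onto V_(-1/2) or V_(1/2) in each argument identifies each
   quotient F^i / F^(i+1), over g_0, with a space of bilinear forms: the
   symmetric forms that see only one of the two summands for i = 1 and -1, and
   the tracefree pairings of V_(-1/2) with V_(1/2) for i = 0.  Raising both
   indices turns these into subspaces of V (x) V.  They are irreducible because
   the rank-two rotations a /\ b with a in V_(1/2), b in V_(-1/2) lie in g_0 and
   carry any nonzero form to decomposable ones, which they then connect to all
   others.  Such a component Z has more than half the dimension m^2 of the tensor
   product, whence the Cartan product: another irreducible component meets Z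
   trivially, so its dimension is at most m^2 - dim Z < dim Z. *)

(** * Modules over a set of Lie algebra elements *)

(** Subtracting [\sum_i ev i v *: s i] from [v] leaves a vector of [S] killed by every [ev i], hence
    zero; applying [ev i] to a linear relation gives freeness. The dimension counts for spaces of
    forms rest on this criterion. *)
Lemma dual_family_basis (F : fieldType) (M : vectType F) (S : {vspace M})
    (I : finType) (s : I -> M) (ev : I -> 'Hom(M, F^o)) :
    (forall i, s i \in S) -> (forall i j, ev i (s j) = (i == j)%:R) ->
    {in S, forall v, (forall i, ev i v = 0) -> v = 0} ->
  \dim S = #|I| /\ {in S, forall v, v = \sum_i (ev i v : F) *: s i}.
Proof.
move=> sS evs evI.
have ev_sum i (k : I -> F) : ev i (\sum_j k j *: s j) = k i.
  rewrite linear_sum (bigD1 i) //= big1 ?addr0 => [|j /negPf ne_ji].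
    by rewrite linearZ /= evs eqxx [LHS]mulr1.
  by rewrite linearZ /= evs eq_sym ne_ji [LHS]mulr0.
have expand : {in S, forall v, v = \sum_i (ev i v : F) *: s i}.
  move=> v vS; apply/eqP; rewrite -subr_eq0; apply/eqP/evI => [|i].
    by rewrite memvB // memv_suml // => i _; rewrite memvZ.
  by rewrite linearB /= ev_sum subrr.
split=> //; pose X := [tuple s (enum_val i) | i < #|I|].
have XE (i : 'I_#|I|) : X`_i = s (enum_val i) by rewrite -tnth_nth tnth_mktuple.
have sumX (k : I -> F) : \sum_i k i *: s i = \sum_(i < #|I|) k (enum_val i) *: X`_i.
  under [RHS]eq_bigr => i _ do rewrite XE.
  by rewrite -(big_enum_val (fun i => k i *: s i)); apply: eq_bigl.
apply: (@size_basis _ _ _ _ X); rewrite /basis_of eqEsubv -andbA; apply/and3P; split.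
- by apply/span_subvP=> _ /mapP[i _ ->].
- apply/subvP=> v /expand ->; rewrite sumX; apply: memv_suml => i _.
  by rewrite memvZ // memv_span // mem_nth // size_tuple.
apply/freeP => k k0 i.
have := ev_sum (enum_val i) (fun j => k (enum_rank j)); rewrite enum_valK => <-.
rewrite sumX; under eq_bigr => j _ do rewrite enum_valK.
by rewrite k0 linear0.
Qed.

Section ModuleLemmas.
Variables (F : fieldType) (L : Type) (a : {pred L}).

Lemma submoduleP (M : vectType F) (rho : L -> 'End(M)) (X : {vspace M}) :
  submodule a rho X <-> {in a, forall x, {in X, forall v, rho x v \in X}}.
Proof.
split=> [aX x ax v vX|aX x ax]; first by rewrite (subvP (aX x ax)) ?memv_img.
by apply/subvP=> _ /memv_imgP[v vX ->]; apply: aX.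
Qed.

Section Isomorphic.
Variables (M N : vectType F) (rhoM : L -> 'End(M)) (rhoN : L -> 'End(N)).
Variables (X : {vspace M}) (Y : {vspace N}).
Hypothesis isoXY : isomorphic a rhoM X rhoN Y.

Lemma isomorphic_dim : \dim X = \dim Y.
Proof.
have [f [injf <- _]] := isoXY; rewrite limg_dim_eq //.
apply/eqP; rewrite -subv0; apply/subvP=> v /memv_capP[vX].
rewrite memv_ker memv0 => /eqP fv0; apply/eqP.
by apply: injf; rewrite ?mem0v // linear0.
Qed.

(** Invariance of [X] is assumed because an intertwiner injective only on [X] cannot recover it from
    that of [Y]. Submodules correspond through images one way and preimages cut down to [X] the
    other way. *)
Lemma isomorphic_irreducible : submodule a rhoM X ->
  irreducible a rhoM X <-> irreducible a rhoN Y.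
Proof.
have [f [injf fX equiv]] := isoXY; move/submoduleP=> aX.
have inX v : v \in X -> f v \in Y by rewrite -fX; apply: memv_img.
have aY : submodule a rhoN Y.
  apply/submoduleP=> x ax w; rewrite -fX => /memv_imgP[v vX ->].
  by rewrite -equiv ?memv_img ?aX.
split=> -[X0 _ Xirr]; split=> //; first 1 last.
- move=> Y' Y'Y /submoduleP aY'; pose X' := (X :&: f @^-1: Y')%VS.
  have fX' : (f @: X' = Y')%VS.
    apply/eqP; rewrite eqEsubv; apply/andP; split; apply/subvP=> w.
      by case/memv_imgP=> v /memv_capP[_]; rewrite -memv_preim => ? ->.
    move=> wY'; have := subvP Y'Y w wY'; rewrite -fX => /memv_imgP[v vX ew].
    by rewrite ew memv_img // memv_cap vX -memv_preim -ew.
  case: (Xirr X') => [||X'0|X'X].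
  + exact: capvSl.
  + apply/submoduleP=> x ax v /memv_capP[vX]; rewrite -memv_preim => fvY'.
    by rewrite memv_cap aX // -memv_preim equiv // aY'.
  + by left; rewrite -fX' X'0 limg0.
  by right; rewrite -fX' X'X.
- by move=> X'0; apply: X0; rewrite -fX X'0 limg0.
- exact/submoduleP.
- move=> X' X'X /submoduleP aX'; have X'P := subvP X'X.
  case: (Xirr (f @: X')%VS) => [||X'0|eX'].
  + by rewrite -fX limgS.
  + apply/submoduleP=> x ax _ /memv_imgP[v vX' ->].
    by rewrite -equiv ?memv_img ?aX' ?X'P.
  + left; apply/eqP; rewrite -subv0; apply/subvP=> v vX'.
    have := memv_img f vX'; rewrite X'0 !memv0 => /eqP fv0; apply/eqP.
    by apply: injf; rewrite ?mem0v ?X'P // linear0.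
  right; apply/eqP; rewrite eqEsubv X'X; apply/subvP=> v vX.
  have := inX v vX; rewrite -eX' => /memv_imgP[u uX' /injf -> //].
  exact: X'P.
move=> Y0; apply: X0; apply/eqP; rewrite -subv0; apply/subvP=> v vX.
have := inX v vX; rewrite Y0 !memv0 => /eqP fv0; apply/eqP.
by apply: injf; rewrite ?mem0v // linear0.
Qed.
End Isomorphic.

Lemma submodule_subquo (M : vectType F) (rho : L -> 'End(M)) (X U : {vspace M}) :
    submodule a rho X -> submodule a rho U ->
  submodule a (fun x => quo_act U (rho x)) (subquo X U).
Proof.
move=> /submoduleP aX aU; apply/submoduleP=> x ax _ /memv_imgP[v vX ->].
by rewrite lfunE /= quo_actE ?aU // -lfunE memv_img ?aX.
Qed.

(** The equivariant first isomorphism theorem, [U] being the kernel of [f] on [X]. *)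
Lemma isomorphic_subquo (M N : vectType F) (rhoM : L -> 'End(M))
    (rhoN : L -> 'End(N)) (X U : {vspace M}) (f : 'Hom(M, N)) :
    (X :&: lker f = U)%VS -> submodule a rhoM U ->
    {in a, forall x, {in X, forall v, f (rhoM x v) = rhoN x (f v)}} ->
  isomorphic a (fun x => quo_act U (rhoM x)) (subquo X U) rhoN (f @: X)%VS.
Proof.
move=> eU aU equiv.
have fU v : v \in U -> f v = 0.
  by rewrite -eU => /memv_capP[_]; rewrite memv_ker => /eqP.
have f_repr v : f (qrepr (qclass U v)) = f v.
  by apply/eqP; rewrite -subr_eq0 -linearB; apply/eqP/fU/qreprP.
(* The choice of representatives [qrepr] need not be linear, but its defect lies in [U], which [f]
   kills. *)
have f_linear : linear (fun c : quotv U => f (qrepr c)).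
  move=> k c d; rewrite -(qreprK c) -(qreprK d) -linearP.
  by rewrite !f_repr linearP.
pose h := linfun (fun c : quotv U => f (qrepr c)).
have hE v : h (qclass U v) = f v by rewrite linfunE // f_repr.
have piE v : linfun (@qclass F M U) v = qclass U v by rewrite lfunE.
exists h; split=> [_ _ /memv_imgP[v vX ->] /memv_imgP[w wX ->]||x ax].
- rewrite !piE !hE => fvw; apply/qclass_eq; rewrite -eU memv_cap memvB //.
  by rewrite memv_ker linearB /= fvw subrr.
- rewrite /subquo -limg_comp.
  apply/vspaceP=> w; apply/memv_imgP/memv_imgP => -[v vX ->]; exists v => //.
    by rewrite comp_lfunE piE hE.
  by rewrite comp_lfunE piE hE.
by move=> _ /memv_imgP[v vX ->]; rewrite piE quo_actE ?aU // !hE equiv.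
Qed.

Lemma mem_tensv (M N : vectType F) (X : {vspace M}) (Y : {vspace N}) u v :
  u \in X -> v \in Y -> tensor u v \in tensv X Y.
Proof.
have tensorDl k w w' z : tensor (k *: w + w') z =
    k *: tensor w z + tensor w' z :> tensprod M N.
  apply/lfunP=> al; rewrite tensprod_linP !tensorE linearP.
  by rewrite scalerDl scalerA.
have tensorDr k w z z' : tensor w (k *: z + z') =
    k *: tensor w z + tensor w z' :> tensprod M N.
  apply/lfunP=> al; rewrite tensprod_linP !tensorE scalerDr !scalerA.
  by rewrite mulrC.
move=> /coord_vbasis -> /coord_vbasis ->.
set w := \sum_(i < _) coord (vbasis Y) i v *: _.
have tensor0l z : tensor 0 z = 0 :> tensprod M N.
  by apply/lfunP=> al; rewrite tensorE linear0 scale0r zero_lfunE.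
have tensor0r z : tensor z 0 = 0 :> tensprod M N.
  by apply/lfunP=> al; rewrite tensorE scaler0 zero_lfunE.
elim/big_rec: _ => [|i x _ IHx]; first by rewrite tensor0l mem0v.
rewrite tensorDl memvD // memvZ // /w.
elim/big_rec: _ => [|j y _ IHy]; first by rewrite tensor0r mem0v.
rewrite tensorDr memvD // memvZ // memv_span //; apply/allpairsP.
by exists ((vbasis X)`_i, (vbasis Y)`_j); rewrite /= !mem_nth ?size_tuple.
Qed.

Lemma cartan_product_dim (M N : vectType F) (rhoM : L -> 'End(M))
    (rhoN : L -> 'End(N)) (X : {vspace M}) (Y : {vspace N})
    (Z : {vspace tensprod M N}) :
    irreducible a (fun x => tens_act (rhoM x) (rhoN x)) Z ->
    (Z <= tensv X Y)%VS -> (\dim X * \dim Y < 2 * \dim Z)%N ->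
  cartan_product a rhoM X rhoN Y Z.
Proof.
move=> Zirr ZXY ltZ; split=> // W [[W0 aW Wirr] WXY] neWZ.
have [Z0 aZ Zmin] := Zirr.
have WZ0 : (W :&: Z = 0)%VS.
  have aWZ : submodule a (fun x => tens_act (rhoM x) (rhoN x)) (W :&: Z)%VS.
    move/submoduleP in aW; move/submoduleP in aZ.
    apply/submoduleP=> x ax v /memv_capP[vW vZ].
    by rewrite memv_cap aW ?aZ.
  have [//|WZZ] := Zmin _ (capvSr W Z) aWZ.
  have [//|WZW] := Wirr _ (capvSl W Z) aWZ.
  by case: neWZ; rewrite -WZW.
(* Only an upper bound on the dimension of [tensv X Y] enters, and the length of its spanning list
   supplies it. *)
have : (\dim W + \dim Z <= \dim X * \dim Y)%N.
  rewrite -dimv_disjoint_sum //.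
  have -> : (\dim X * \dim Y = size [seq tensor v w | v <- vbasis X, w <- vbasis Y])%N.
    by rewrite size_allpairs !size_tuple.
  by apply: leq_trans (dim_span _); apply: dimvS; rewrite subv_add WXY.
by move=> /leq_ltn_trans /(_ ltZ); rewrite mul2n -addnn ltn_add2r.
Qed.
End ModuleLemmas.

(** * Orthogonal geometry *)

Section Tensor2.
Variables (K : fieldType) (V : vectType K).
Implicit Types (Phi Psi : tensor2 V) (u v w : V).

Lemma tensor2B Phi Psi u v : (Phi - Psi) u v = Phi u v - Psi u v.
Proof. by rewrite [X in fun_of_lfun X v]add_lfunE add_lfunE tensor2N. Qed.

Lemma tensor2D Phi Psi u v : (Phi + Psi) u v = Phi u v + Psi u v.
Proof. by rewrite [X in fun_of_lfun X v]add_lfunE add_lfunE. Qed.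

Lemma tensor2Z k Phi u v : (k *: Phi) u v = k * Phi u v.
Proof. by rewrite [X in fun_of_lfun X v]scale_lfunE scale_lfunE. Qed.

Lemma tensor2Zl Phi k u w : Phi (k *: u) w = k * Phi u w.
Proof. by rewrite linearZ scale_lfunE. Qed.

Lemma tensor2Dl Phi u v w : Phi (u + v) w = Phi u w + Phi v w.
Proof. by rewrite linearD add_lfunE. Qed.

Lemma tensor2Nl Phi u w : Phi (- u) w = - Phi u w.
Proof. by rewrite linearN opp_lfunE. Qed.

Lemma tensor2Bl Phi u v w : Phi (u - v) w = Phi u w - Phi v w.
Proof. by rewrite tensor2Dl tensor2Nl. Qed.

Lemma tensor2Zr Phi k u w : Phi w (k *: u) = k * Phi w u.
Proof. by rewrite linearZ. Qed.

Lemma tensor2Dr Phi u v w : Phi w (u + v) = Phi w u + Phi w v.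
Proof. by rewrite linearD. Qed.

Lemma tensor2Nr Phi u w : Phi w (- u) = - Phi w u.
Proof. by rewrite linearN. Qed.

Lemma tensor2Br Phi u v w : Phi w (u - v) = Phi w u - Phi w v.
Proof. by rewrite tensor2Dr tensor2Nr. Qed.

Lemma tensor2_suml Phi (I : finType) (k : I -> K) (s : I -> V) w :
  Phi (\sum_i k i *: s i) w = \sum_i k i * Phi (s i) w.
Proof.
rewrite linear_sum sum_lfunE; apply: eq_bigr => i _.
exact: tensor2Zl.
Qed.

Lemma tensor2_sumr Phi (I : finType) (k : I -> K) (s : I -> V) w :
  Phi w (\sum_i k i *: s i) = \sum_i k i * Phi w (s i).
Proof.
by rewrite linear_sum; apply: eq_bigr => i _; apply: tensor2Zr.
Qed.
End Tensor2.

Section QuadraticSpace.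
Variables (K : fieldType) (V : vectType K) (g : tensor2 V).
Hypothesis hg : nondegenerate_symmetric g.
Implicit Types (Phi Psi phi : tensor2 V) (u v w x y : V).

Lemma formC u v : g u v = g v u.
Proof. by have /andP[/symm2P] := hg. Qed.

(** [g] is injective between spaces of equal dimension, so its image is the whole dual and the
    generalised inverse [g^-1] is a genuine right inverse. *)
Lemma sharpK (al : dual V) : g (sharp g al) = al.
Proof.
have /andP[_ g0] := hg; apply: limg_lfunVK.
have -> : limg g = fullv; last exact: memvf.
apply/eqP; rewrite eqEdim subvf limg_dim_eq ?(eqP g0) ?capv0 //.
by rewrite !dimvf /dim /= muln1.
Qed.

Lemma sharpE al u : g (sharp g al) u = al u.
Proof. by rewrite sharpK. Qed.

Lemma form_inj u v : (forall w, g u w = g v w) -> u = v.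
Proof.
have /andP[_ /lker0P ginj] := hg; move=> e; apply: ginj.
exact/lfunP.
Qed.

Lemma so_actE phi u v : g (so_act g phi u) v = phi v u.
Proof. by rewrite comp_lfunE sharpE transpE. Qed.

Lemma so_act_skew phi u v : phi \in skew2 V ->
  g (so_act g phi u) v = - g u (so_act g phi v).
Proof. by move=> /skew2P sk; rewrite so_actE sk formC so_actE. Qed.

(** The decomposable tensor [u_a v_b], indices lowered by [g]. *)
Definition formprod u v : tensor2 V := linfun (fun x => (g u x : K) *: g v).

Lemma formprodE u v x y : formprod u v x y = g u x * g v y.
Proof.
rewrite linfunE ?scale_lfunE // => k z z'.
by rewrite linearP scalerDl scalerA.
Qed.

(** The bivector [u /\ v] as an element of so(V), acting as an infinitesimal rotation of rank at
    most two. *)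
Definition rot u v : tensor2 V := formprod u v - formprod v u.

Lemma rot_skew u v : rot u v \in skew2 V.
Proof.
apply/skew2P=> x y; rewrite !tensor2B !formprodE opprB.
by rewrite ![g u _ * _]mulrC.
Qed.

Lemma rot_act u v x : so_act g (rot u v) x = g v x *: u - g u x *: v.
Proof.
apply: form_inj => y; rewrite so_actE tensor2B !formprodE.
by rewrite tensor2Bl !tensor2Zl [g v x * _]mulrC [g u x * _]mulrC.
Qed.

(** Raises both indices, moving covariant tensors into the tensor product in which Cartan products
    are taken. *)
Definition raise2 : 'Hom(tensor2 V, tensprod V V) :=
  linfun (fun Phi => (sharp g \o (Phi \o sharp g))%VF : tensprod V V).

Lemma raise2E Phi al : raise2 Phi al = sharp g (Phi (sharp g al)).
Proof.
rewrite linfunE ?comp_lfunE // => k P Q; apply/lfunP=> be.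
by rewrite tensprod_linP !comp_lfunE add_lfunE scale_lfunE linearP.
Qed.

Lemma raise2_inj : injective raise2.
Proof.
move=> P Q e; apply/lfunP=> u; have /lfunP/(_ (g u)) := e.
rewrite !raise2E => /(congr1 g); rewrite !sharpK.
suff -> : sharp g (g u) = u by [].
by apply: form_inj => w; rewrite sharpE.
Qed.

Lemma raise2_formprod u v : raise2 (formprod u v) = tensor u v.
Proof.
apply/lfunP=> al; rewrite raise2E tensorE; apply: form_inj => w.
by rewrite sharpE formprodE formC sharpE tensor2Zl.
Qed.

(** The minus signs of the action on covariant tensors are absorbed by the skewness of
    [so_act g phi] with respect to [g]. *)
Lemma raise2_act phi Phi : phi \in skew2 V ->
  raise2 (filt_act g phi Phi) =
  tens_act (so_act g phi) (so_act g phi) (raise2 Phi).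
Proof.
move=> sk; apply/lfunP=> al; rewrite tens_actE add_lfunE.
rewrite (comp_lfunE (so_act g phi)) (comp_lfunE _ (dualmap _)) !raise2E.
apply: form_inj => w; rewrite sharpE tensor2_actE.
rewrite tensor2Dl so_act_skew // !sharpE addrC; congr (_ + _).
rewrite -tensor2N; have -> : sharp g (dualmap (so_act g phi) al) =
    - so_act g phi (sharp g al); last by rewrite linearN tensor2N opp_lfunE.
apply: form_inj => x; rewrite sharpE dualmapE tensor2Nl so_act_skew // sharpE.
by rewrite opprK.
Qed.

(** This frees the trace from the basis [vbasis {:V}] of its definition: expanding along the [s k]
    and exchanging sums recombines the coordinates of each [s k] into [s k] itself. *)
Lemma tr2_dual_family (I : finType) (s t : I -> V) Phi :
  (forall v, v = \sum_i (g (t i) v : K) *: s i) ->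
  tr2 g Phi = \sum_i Phi (s i) (t i).
Proof.
move=> expand; rewrite /tr2; set b := vbasis _; rewrite /mxtrace.
have bP : basis_of {:V} b by apply: vbasisP.
have diag i : passmx.mxof b b (sharp g \o Phi)%VF i i =
    \sum_k coord b i (s k) * g (t k) (sharp g (Phi b`_i)).
  rewrite mxE /= passmx.vecof_delta comp_lfunE mxE.
  rewrite [X in coord b i X]expand linear_sum; apply: eq_bigr => k _.
  by rewrite linearZ mulrC.
rewrite (eq_bigr _ (fun i _ => diag i)) exchange_big /=; apply: eq_bigr => k _.
rewrite {2}[s k](coord_basis bP) ?memvf // linear_sum sum_lfunE.
apply: eq_bigr => i _.
by rewrite linearZ scale_lfunE formC sharpE.
Qed.
End QuadraticSpace.

Lemma daddv_pi0 (K : fieldType) (V : vectType K) (A B : {vspace V}) v :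
  (A :&: B = 0)%VS -> v \in B -> daddv_pi A B v = 0.
Proof.
move=> AB vB; have BA : (B :&: A = 0)%VS by rewrite capvC.
have vAB : v \in (A + B)%VS by rewrite (subvP (addvSr A B)).
have /eqP := daddv_pi_add AB vAB.
by rewrite (daddv_pi_id BA) // -subr_eq0 addrK => /eqP.
Qed.

(** * Splittings into two null subspaces, and frames dual under the form *)

Section NullSplitting.
Variables (K : fieldType) (V : vectType K) (g : tensor2 V).
Hypothesis hg : nondegenerate_symmetric g.
Implicit Types (Phi Psi phi : tensor2 V) (u v w x y : V) (A B : {vspace V}).

Definition null_splitting A B :=
  [/\ totally_null g A, totally_null g B, (A + B = fullv)%VS & (A :&: B = 0)%VS].

Lemma null_splittingC A B : null_splitting A B -> null_splitting B A.
Proof. by move=> [nA nB sAB cAB]; split; rewrite // ?(addvC B) // capvC. Qed.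

Definition null_frame n A B (e f : 'I_n -> V) :=
  [/\ forall i, e i \in A, forall i, f i \in B,
      forall i j, g (e i) (f j) = (i == j)%:R,
      {in A, forall v, v = \sum_i (g (f i) v : K) *: e i}
    & {in B, forall v, v = \sum_i (g (e i) v : K) *: f i}].

Lemma null_frameC n A B (e f : 'I_n -> V) :
  null_frame A B e f -> null_frame B A f e.
Proof. by move=> [? ? ef ? ?]; split=> // i j; rewrite formC // ef eq_sym. Qed.

Section Splitting.
Variables A B : {vspace V}.
Hypothesis AB : null_splitting A B.

Lemma splitting_decomp v : exists2 a, a \in A & exists2 b, b \in B & v = a + b.
Proof.
have [_ _ sAB _] := AB; have: v \in (A + B)%VS by rewrite sAB memvf.
by move=> /memv_addP[a aA [b bB ->]]; exists a => //; exists b.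
Qed.

Lemma splitting_eq0 u : {in A, forall v, g u v = 0} -> {in B, forall v, g u v = 0} ->
  u = 0.
Proof.
move=> uA uB; apply: (form_inj hg) => w; rewrite linear0 zero_lfunE.
by have [a aA [b bB ->]] := splitting_decomp w; rewrite linearD /= uA ?uB ?addr0.
Qed.

(** The B-part of [u] is orthogonal to [A] by hypothesis, as [A] is null, and to [B] because [B] is
    null; so it vanishes by nondegeneracy. *)
Lemma null_perp u : {in A, forall v, g u v = 0} -> u \in A.
Proof.
have [nA nB _ _] := AB.
have [a aA [b bB ->]] := splitting_decomp u => ab0; suff -> : b = 0 by rewrite addr0.
apply: splitting_eq0 => v vX; last exact: nB.
by have := ab0 v vX; rewrite tensor2Dl nA ?add0r.
Qed.

Lemma null_pairing u : u \in A -> u != 0 -> exists2 b, b \in B & g u b = 1.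
Proof.
have [nA nB _ _] := AB; move=> uA u0.
have [/forallP all0|] := boolP [forall i : 'I_(\dim B), g u (vbasis B)`_i == 0].
  case/eqP: u0; apply: splitting_eq0 => v vX; first exact: nA.
  rewrite (coord_vbasis vX) linear_sum big1 // => i _.
  by rewrite linearZ /= (eqP (all0 i)) scaler0.
case/forallPn=> i gub; exists ((g u (vbasis B)`_i)^-1 *: (vbasis B)`_i).
  by rewrite memvZ // vbasis_mem // mem_nth ?size_tuple.
by rewrite linearZ; apply: mulVf.
Qed.

End Splitting.

(** [e] is a basis of [A], and [f i] represents the i-th coordinate functional extended by zero on
    [B]. Being orthogonal to [B], it lies in [B] by [null_perp]. *)
Lemma null_frame_exists A B n : null_splitting A B -> \dim A = n ->
  exists e f : 'I_n -> V, null_frame A B e f.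
Proof.
move=> AB; have [nA nB sAB cAB] := AB; move=> <-.
pose e (i : 'I_(\dim A)) := (vbasis A)`_i.
have eA i : e i \in A by rewrite vbasis_mem // mem_nth ?size_tuple.
pose c (i : 'I_(\dim A)) v : K^o := coord (vbasis A) i (daddv_pi A B v).
have c_lin i : linear (c i) by move=> k u v; rewrite /c !linearP.
pose f i := sharp g (linfun (c i) : dual V).
have fE i v : g (f i) v = c i v by rewrite sharpE // linfunE.
have fA i v : v \in A -> g (f i) v = coord (vbasis A) i v.
  by move=> vA; rewrite fE /c daddv_pi_id.
have fB i : f i \in B.
  apply: (null_perp (null_splittingC AB)) => v vB.
  by rewrite fE /c daddv_pi0 ?linear0.
have ef i j : g (e i) (f j) = (i == j)%:R.
  by rewrite formC // fA // coord_free ?(basis_free (vbasisP A)) // eq_sym.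
have expA : {in A, forall v, v = \sum_i (g (f i) v : K) *: e i}.
  by move=> v vA; rewrite {1}(coord_vbasis vA); apply: eq_bigr => i _; rewrite fA.
exists e, f; split=> // v vB; apply/eqP; rewrite -subr_eq0; apply/eqP.
have sB : \sum_i (g (e i) v : K) *: f i \in B.
  by apply: memv_suml => i _; rewrite memvZ.
apply: (splitting_eq0 AB) => w wX; last by rewrite nB // memvB.
have ez i : g (e i) (v - \sum_i (g (e i) v : K) *: f i) = 0.
  rewrite linearB linear_sum (bigD1 i) //= big1 => [|j /negPf ne_ji].
    by rewrite linearZ /= ef eqxx [_ *: _]mulr1 addr0 subrr.
  by rewrite linearZ /= ef eq_sym ne_ji [LHS]mulr0.
rewrite formC // (expA _ wX) linear_sum sum_lfunE big1 // => i _.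
by rewrite tensor2Zl ez mulr0.
Qed.
End NullSplitting.

(** * The irreducible spaces of bilinear forms *)

Section Components.
Variables (K : fieldType) (V : vectType K) (g : tensor2 V).
Hypothesis hg : nondegenerate_symmetric g.
Hypothesis K0 : [pchar K] =i pred0.
Implicit Types (Phi Psi phi : tensor2 V) (u v w x y : V) (A B : {vspace V}).

(** Precomposing with the projector onto [A] expresses vanishing for first arguments in [A] as a
    kernel, hence as a subspace. *)
Definition vanish (A : {vspace V}) : {vspace tensor2 V} :=
  lker (linfun (fun Phi : tensor2 V => (Phi \o projv A)%VF)).

Lemma vanishP A Phi : reflect {in A, forall u v, Phi u v = 0} (Phi \in vanish A).
Proof.
rewrite memv_ker linfunE => [|k P Q]; last by rewrite comp_lfunDl -comp_lfunZl.
apply: (iffP eqP) => [e u uA v|e].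
  have /lfunP/(_ u) := e; rewrite comp_lfunE projv_id // => ->.
  by rewrite !zero_lfunE.
apply/tensor2P=> u v; rewrite comp_lfunE e ?memv_proj //.
by rewrite !zero_lfunE.
Qed.

(** When [A] is a summand of a null splitting it is its own orthogonal complement, so raising
    indices turns this space into the symmetric square of [A]. *)
Definition symm_vanish A : {vspace tensor2 V} := (symm2 V :&: vanish A)%VS.

(** For a null splitting, raising indices gives the tracefree part of the tensor product of [A] and
    [B], a copy of sl(A). *)
Definition mixed_vanish A B : {vspace tensor2 V} :=
  (vanish A :&: (transp V @^-1: vanish B) :&: lker (linfun (tr2 g)))%VS.

Lemma symm_vanishP A Phi : reflect
  ((forall u v, Phi u v = Phi v u) /\ {in A, forall u v, Phi u v = 0})
  (Phi \in symm_vanish A).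
Proof. by rewrite memv_cap; apply: (iffP andP) => -[/symm2P ? /vanishP]. Qed.

Lemma mixed_vanishP A B Phi : reflect
  [/\ {in A, forall u v, Phi u v = 0}, {in B, forall v u, Phi u v = 0}
    & tr2 g Phi = 0]
  (Phi \in mixed_vanish A B).
Proof.
rewrite memv_cap [X in _ && X]memv_ker (linfunE (@tr2_linear _ _ g)).
rewrite memv_cap -memv_preim -andbA.
apply: (iffP and3P) => -[/vanishP PA PB /eqP ->]; split=> //.
  by move=> v vB u; rewrite -(transpE Phi v u); move/vanishP: PB; apply.
by apply/vanishP=> v vB u; rewrite transpE PB.
Qed.

Definition eval2 u v : 'Hom(tensor2 V, K^o) :=
  linfun (fun Phi : tensor2 V => Phi u v : K^o).

Lemma eval2E u v Phi : eval2 u v Phi = Phi u v.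
Proof. by rewrite linfunE // => k P Q; apply: tensor2_linP. Qed.

Lemma filt_act_formprod phi u v : phi \in skew2 V ->
  filt_act g phi (formprod g u v) =
  formprod g (so_act g phi u) v + formprod g u (so_act g phi v).
Proof.
move=> sk; apply/tensor2P=> x y.
by rewrite tensor2_actE tensor2D !formprodE !so_act_skew //; ring.
Qed.

(** With one index raised, the action of [phi] becomes the commutator with [so_act g phi], and
    commutators are traceless. *)
Lemma tr2_act phi Phi : phi \in skew2 V -> tr2 g (filt_act g phi Phi) = 0.
Proof.
move=> sk; set X := so_act g phi; set N := (sharp g \o Phi)%VF.
have eXN : (sharp g \o filt_act g phi Phi)%VF = ((X \o N) - (N \o X))%VF.
  apply/lfunP=> u; apply: (form_inj hg) => w.
  rewrite comp_lfunE sharpE // tensor2_actE add_lfunE opp_lfunE tensor2Bl.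
  rewrite !(comp_lfunE X) !(comp_lfunE N) so_act_skew // /N !comp_lfunE.
  by rewrite !sharpE // addrC.
have bP := vbasisP {:V}.
rewrite /tr2 eXN addrC -scaleN1r passmx.mxof_linear mxtraceD mxtraceZ.
by rewrite !(passmx.mxof_comp _ _ bP) mxtrace_mulC mulN1r addNr.
Qed.

Section Frame.
Variables (A B : {vspace V}) (n : nat) (e f : 'I_n -> V).
Hypotheses (AB : null_splitting g A B) (ef : null_frame g A B e f).

Let nA : totally_null g A. Proof. by case: AB. Qed.
Let nB : totally_null g B. Proof. by case: AB. Qed.
Let eA i : e i \in A. Proof. by case: ef. Qed.
Let fB i : f i \in B. Proof. by case: ef. Qed.
Let gef i j : g (e i) (f j) = (i == j)%:R. Proof. by case: ef. Qed.
Let gfe i j : g (f i) (e j) = (i == j)%:R.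
Proof. by rewrite formC // gef eq_sym. Qed.
Let expA u : u \in A -> u = \sum_i (g (f i) u : K) *: e i.
Proof. by move=> uA; case: ef => _ _ _ /(_ u uA). Qed.
Let expB u : u \in B -> u = \sum_i (g (e i) u : K) *: f i.
Proof. by move=> uB; case: ef => _ _ _ _ /(_ u uB). Qed.

Lemma rot_actB a b x : b \in B -> x \in B -> so_act g (rot g a b) x = - g a x *: b.
Proof. by move=> bB xB; rewrite rot_act // nB // scale0r sub0r scaleNr. Qed.

Lemma rot_actA a b x : a \in A -> x \in A -> so_act g (rot g a b) x = g b x *: a.
Proof. by move=> aA xA; rewrite rot_act // [g a x]nA // scale0r subr0. Qed.

Lemma frame_eq0 Phi :
    (forall i j, Phi (e i) (e j) = 0) -> (forall i j, Phi (e i) (f j) = 0) ->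
    (forall i j, Phi (f i) (e j) = 0) -> (forall i j, Phi (f i) (f j) = 0) ->
  Phi = 0.
Proof.
move=> Pee Pef Pfe Pff; apply/tensor2P => u v; rewrite !zero_lfunE.
have sum0 (s t : 'I_n -> V) : (forall i j, Phi (s i) (t j) = 0) ->
    forall k l : 'I_n -> K, Phi (\sum_i k i *: s i) (\sum_j l j *: t j) = 0.
  move=> st0 k l; rewrite tensor2_suml big1 // => i _.
  by rewrite tensor2_sumr big1 ?mulr0 // => j _; rewrite st0 mulr0.
have [a aA [b bB ->]] := splitting_decomp AB u.
have [c cA [d dB ->]] := splitting_decomp AB v.
rewrite (expA aA) (expB bB) (expA cA) (expB dB) tensor2Dl !tensor2Dr.
by rewrite !sum0 ?addr0.
Qed.

Lemma tr2_frame Phi : tr2 g Phi = \sum_i (Phi (e i) (f i) + Phi (f i) (e i)).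
Proof.
pose s (i : 'I_n + 'I_n) := match i with inl i => e i | inr i => f i end.
pose t (i : 'I_n + 'I_n) := match i with inl i => f i | inr i => e i end.
rewrite (@tr2_dual_family _ _ _ hg _ s t) => [|v].
  by rewrite big_sumType big_split.
rewrite big_sumType /=.
have [a aA [b bB ->]] := splitting_decomp AB v.
rewrite {1}(expA aA) {1}(expB bB); congr (_ + _); apply: eq_bigr => i _.
  by rewrite linearD /= [g _ b]nB // addr0.
by rewrite linearD /= [g _ a]nA // add0r.
Qed.

(** * Symmetric forms: basis, dimension and irreducibility *)

Definition upper_triangle := [pred ij : 'I_n * 'I_n | (ij.1 <= ij.2)%N].

(** The upper and lower triangles have equal size by transposition; their union is the full square
    and their intersection the diagonal, which gives [n ^ 2 + n]. *)
Lemma card_upper_triangle : (2 * #|upper_triangle| = n * (n + 1))%N.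
Proof.
pose low := [pred ij : 'I_n * 'I_n | (ij.2 <= ij.1)%N].
pose diag := [pred ij : 'I_n * 'I_n | ij.1 == ij.2].
have clow : #|low| = #|upper_triangle|.
  pose sw (ij : 'I_n * 'I_n) := (ij.2, ij.1).
  have swK : involutive sw by case.
  by rewrite -(card_image (inv_inj swK)); apply: eq_card => ij;
    rewrite -[ij]swK mem_image ?inE //; apply: inv_inj.
have cdiag : #|diag| = n.
  rewrite -[RHS]card_ord -(card_image (f := fun i : 'I_n => (i, i))) => [|i j [] //].
  apply: eq_card => -[i j]; rewrite inE /=; apply/eqP/imageP => [->|[k _ [-> ->]]] //.
  by exists j.
rewrite mul2n -addnn -{1}clow -cardUI addnC mulnDr muln1 addnC.
congr (_ + _)%N.
  transitivity #|{: 'I_n * 'I_n}|; last by rewrite card_prod card_ord.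
  apply: eq_card => ij.
  by rewrite !inE /= leq_total.
by rewrite -[RHS]cdiag; apply: eq_card => ij; rewrite !inE /= -eqn_leq eq_sym.
Qed.

(* The diagonal is kept apart so that the family is dual to the evaluations at
   (f i, f j), i <= j. *)
Definition symm_family (ij : 'I_n * 'I_n) : tensor2 V :=
  formprod g (e ij.1) (e ij.2) +
  (if ij.1 == ij.2 then 0 else formprod g (e ij.2) (e ij.1)).

Lemma symm_family_mem ij : symm_family ij \in symm_vanish A.
Proof.
apply/symm_vanishP; split=> [u v|u uA v]; rewrite !tensor2D; case: eqP => [->|_];
  rewrite ?zero_lfunE !formprodE; try ring.
  by rewrite nA // mul0r addr0.
by rewrite ![g _ u]nA // !mul0r addr0.
Qed.

Lemma symm_vanish_basis :
  \dim (symm_vanish A) = #|upper_triangle| /\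
  {in symm_vanish A, forall Psi, Psi = \sum_(ij : {ij | upper_triangle ij})
     (Psi (f (val ij).1) (f (val ij).2) : K) *: symm_family (val ij)}.
Proof.
have [|||dimS expS] := @dual_family_basis _ _ (symm_vanish A)
  {ij | upper_triangle ij} (fun ij => symm_family (val ij))
  (fun ij => eval2 (f (val ij).1) (f (val ij).2)).
- by move=> ij; apply: symm_family_mem.
- move=> [[i j] /= leij] [[k l] /= lekl].
  rewrite eval2E tensor2D /= formprodE !gef.
  rewrite [RHS](_ : _ = ((i, j) == (k, l))%:R) // xpair_eqE.
  rewrite [k == i]eq_sym [l == j]eq_sym -natrM mulnb.
  case: ifPn => [_|nekl]; first by rewrite !zero_lfunE addr0.
  rewrite formprodE !gef -natrM mulnb.
  suff -> : (l == i) && (k == j) = false by rewrite addr0.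
  apply/negP=> /andP[/eqP li /eqP kj]; case/eqP: nekl; apply: val_inj.
  by apply/eqP; rewrite eqn_leq lekl li kj leij.
- move=> Psi /symm_vanishP[sym PA] ev0; apply: frame_eq0 => i j.
  + exact: PA.
  + exact: PA.
  + by rewrite sym PA.
  have [le|/ltnW le] := leqP i j.
    by have := ev0 (exist _ (i, j) le); rewrite eval2E.
  by have := ev0 (exist _ (j, i) le); rewrite eval2E sym.
split; first by rewrite dimS card_sig.
by move=> Psi /expS {1}->; apply: eq_bigr => ij _; rewrite eval2E.
Qed.

Lemma symm_vanish_sub (W : {vspace tensor2 V}) :
    {in A &, forall u v, formprod g u v + formprod g v u \in W} ->
  (symm_vanish A <= W)%VS.
Proof.
move=> sW; apply/subvP=> Psi PS.
have [_ /(_ Psi PS) ->] := symm_vanish_basis.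
apply: memv_suml => -[[i j] /= _] _; apply: memvZ; rewrite /symm_family /=.
case: eqP => [->|_]; last exact: sW.
(* On the diagonal the symmetric product is twice the family member, so 2 must be inverted. *)
have := sW (e j) (e j) (eA _) (eA _); rewrite -mulr2n -scaler_nat addr0.
move/(memvZ 2^-1); rewrite scalerA mulVf ?scale1r //.
by have /pcharf0P -> := K0.
Qed.

(* a /\ b maps Psi to the symmetric product of g(a, .) with Psi(b, .): this gives
   all products with one fixed factor c, and a second rotation frees c. *)
Lemma symm_vanish_irr (W : {vspace tensor2 V}) :
    (W <= symm_vanish A)%VS -> W <> 0%VS ->
    {in A & B, forall a b, {in W, forall Psi, filt_act g (rot g a b) Psi \in W}} ->
  W = symm_vanish A.
Proof.
move=> WS W0 actW; apply/eqP; rewrite eqEsubv WS /=.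
have [Psi PW Psi0] : exists2 Psi, Psi \in W & Psi != 0.
  by exists (vpick W); rewrite ?memv_pick // vpick0; apply/eqP.
have [sym PA] := symm_vanishP _ _ (subvP WS _ PW).
have [b bB Pb0] : exists2 b, b \in B & Psi b != 0.
  have [/forallP all0|/forallPn[i Pfi]] := boolP [forall i, Psi (f i) == 0].
    case/eqP: Psi0; apply: frame_eq0 => i j; try exact: PA;
    by rewrite (eqP (all0 i)) zero_lfunE.
  by exists (f i).
pose c := sharp g (Psi b); have gc w : g c w = Psi b w by rewrite sharpE.
have cA : c \in A by apply: (null_perp hg AB) => w wA; rewrite gc sym PA.
have c0 : c != 0.
  by apply: contraNneq Pb0 => c0; apply/eqP/lfunP=> w; rewrite -gc c0 linear0.
have acW : {in A, forall a, formprod g a c + formprod g c a \in W}.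
  move=> a aA; have := actW a b aA bB Psi PW; congr (_ \in W).
  apply/tensor2P=> x y; rewrite tensor2_actE !rot_act // tensor2D !formprodE !gc.
  rewrite !(tensor2Bl, tensor2Br, tensor2Zl, tensor2Zr) [Psi x b]sym.
  by rewrite [Psi x a]sym !(PA a aA); ring.
have [d dB gcd] := null_pairing hg AB cA c0.
apply: symm_vanish_sub => a a' aA a'A.
(* Since [g c d = 1], the rotation [a' /\ d] sends [c] to [a'] and [a] to [g d a *: a']. The second
   effect is a product with factor [c], already in [W], and is subtracted. *)
have -> : formprod g a a' + formprod g a' a =
    filt_act g (rot g a' d) (formprod g a c + formprod g c a)
    - g d a *: (formprod g a' c + formprod g c a').
  apply/tensor2P=> x y; rewrite linearD /= !filt_act_formprod ?rot_skew //.
  rewrite !rot_actA // [g d c]formC // gcd.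
  by rewrite !(tensor2B, tensor2Z, tensor2D, formprodE, tensor2Zl); ring.
by rewrite memvB ?memvZ ?actW ?acW.
Qed.

(** * Tracefree mixed forms: basis, dimension and irreducibility *)

Definition off_corner (i0 : 'I_n) := [pred ij : 'I_n * 'I_n | ij != (i0, i0)].

Lemma card_off_corner i0 : #|off_corner i0| = (n ^ 2 - 1)%N.
Proof.
have := cardC (pred1 (i0, i0)); rewrite card1 card_prod card_ord mulnn => <-.
by rewrite addKn.
Qed.

(** Diagonal products are made tracefree by subtracting the corner product. At [(i0, i0)] the result
    is zero, which is why [off_corner] omits that index. *)
Definition mixed_family i0 (ij : 'I_n * 'I_n) : tensor2 V :=
  formprod g (e ij.1) (f ij.2) -
  (if ij.1 == ij.2 then formprod g (e i0) (f i0) else 0).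

Lemma tr2_formprod a b : a \in A -> b \in B -> tr2 g (formprod g a b) = g a b.
Proof.
move=> aA bB; rewrite tr2_frame {3}(expB bB) tensor2_sumr.
apply: eq_bigr => i _; rewrite !formprodE [g a _]nA // mul0r add0r.
by rewrite mulrC [g b _]formC.
Qed.

Lemma mixed_family_mem i0 ij : mixed_family i0 ij \in mixed_vanish A B.
Proof.
apply/mixed_vanishP; split=> [u uA v|v vB u|].
- rewrite tensor2B; case: eqP => _; rewrite ?zero_lfunE !formprodE.
    by rewrite ![g (e _) u]nA // !mul0r subrr.
  by rewrite ![g (e _) u]nA // !mul0r subrr.
- rewrite tensor2B; case: eqP => _; rewrite ?zero_lfunE !formprodE.
    by rewrite ![g (f _) v]nB // !mulr0 subrr.
  by rewrite ![g (f _) v]nB // !mulr0 subrr.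
have -> : tr2 g (mixed_family i0 ij) = linfun (tr2 g) (mixed_family i0 ij).
  by rewrite linfunE //; apply: tr2_linear.
rewrite linearB /= !linfunE; try exact: tr2_linear.
rewrite tr2_formprod // gef; case: eqP => _; last first.
  by rewrite -(linfunE (@tr2_linear _ _ g)) linear0 subrr.
by rewrite tr2_formprod // gef eqxx subrr.
Qed.

Lemma mixed_vanish_basis i0 :
  \dim (mixed_vanish A B) = #|off_corner i0| /\
  {in mixed_vanish A B, forall Psi, Psi = \sum_(ij : {ij | off_corner i0 ij})
     (Psi (f (val ij).1) (e (val ij).2) : K) *: mixed_family i0 (val ij)}.
Proof.
have [|||dimS expS] := @dual_family_basis _ _ (mixed_vanish A B)
  {ij | off_corner i0 ij} (fun ij => mixed_family i0 (val ij))
  (fun ij => eval2 (f (val ij).1) (e (val ij).2)).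
- by move=> ij; apply: mixed_family_mem.
- move=> [[i j] /= ij0] [[k l] /= kl0].
  rewrite eval2E tensor2B /= formprodE gef gfe.
  rewrite [RHS](_ : _ = ((i, j) == (k, l))%:R) // xpair_eqE.
  rewrite [k == i]eq_sym [l == j]eq_sym -natrM mulnb.
  case: ifPn => [_|_]; last by rewrite !zero_lfunE subr0.
  rewrite formprodE gef gfe -natrM mulnb.
  suff -> : (i0 == i) && (i0 == j) = false by rewrite subr0.
  by apply: contraNF ij0 => /andP[/eqP <- /eqP <-].
- move=> Psi /mixed_vanishP[PA PB tr0] ev0.
  have Pfe ij : off_corner i0 ij -> Psi (f ij.1) (e ij.2) = 0.
    by move=> ij0; have := ev0 (exist _ ij ij0); rewrite eval2E.
  apply: frame_eq0 => i j; try (exact: PA); try exact: PB.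
  have [[-> ->]|/eqP ij0] := (i, j) =P (i0, i0); last exact: (Pfe (i, j)).
  (* The corner value is the one no evaluation reads off; the trace condition determines it from the
     other diagonal values. *)
  rewrite -[RHS]tr0 tr2_frame (bigD1 i0) //= (PA _ (eA i0)) add0r.
  rewrite big1 ?addr0 // => k ki0; rewrite (PA _ (eA k)) add0r.
  by apply: (Pfe (k, k)); rewrite inE xpair_eqE (negPf ki0).
split; first by rewrite dimS card_sig.
by move=> Psi /expS {1}->; apply: eq_bigr => ij _; rewrite eval2E.
Qed.

(** The nilpotent rank-one maps span the tracefree ones: a difference of two diagonal products is
    rewritten through [e i + e i0] and [f i - f i0], which are orthogonal. *)
Lemma mixed_vanish_sub (W : {vspace tensor2 V}) : (0 < n)%N ->
    {in A & B, forall a b, g a b = 0 -> formprod g a b \in W} ->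
  (mixed_vanish A B <= W)%VS.
Proof.
move=> n_gt0 sW; apply/subvP=> Psi PS; pose i0 := Ordinal n_gt0.
have [_ /(_ Psi PS) ->] := mixed_vanish_basis i0.
apply: memv_suml => -[[i j] /= _] _; apply: memvZ; rewrite /mixed_family /=.
have [<-|/eqP/negPf ne_ij] := i =P j; last first.
  by rewrite subr0 sW // gef ne_ij.
have [<-|/eqP/negPf ne_ii0] := i =P i0; first by rewrite subrr mem0v.
have -> : formprod g (e i) (f i) - formprod g (e i0) (f i0) =
    formprod g (e i + e i0) (f i - f i0) + formprod g (e i) (f i0)
    - formprod g (e i0) (f i).
  apply/tensor2P=> x y.
  by rewrite !(tensor2B, tensor2D, formprodE, tensor2Bl, tensor2Dl); ring.
rewrite memvB ?memvD ?sW ?gef ?ne_ii0 ?memvB ?memvD // 1?eq_sym ?ne_ii0 //.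
by rewrite tensor2Dl !tensor2Br !gef !eqxx [i0 == i]eq_sym ne_ii0 subr0 sub0r subrr.
Qed.

Lemma null_orthogonal u v : (2 < n)%N ->
  exists2 b, b \in B & [/\ b != 0, g u b = 0 & g v b = 0].
Proof.
move=> n_gt2.
have dimB : \dim B = n.
  have [|||->] := @dual_family_basis _ _ B 'I_n f (fun i => g (e i) : 'Hom(V, K^o)).
  - by [].
  - by [].
  - move=> w wB g0; rewrite (expB wB) big1 // => i _.
    by rewrite g0 scale0r.
  by rewrite card_ord.
(* Each linear condition lowers the dimension by at most one, so two of them leave a nonzero vector
   in [B]. *)
have cap_dim (U : {vspace V}) (h : dual V) : (\dim U <= (\dim (U :&: lker h)).+1)%N.
  rewrite -(limg_ker_dim h U) -addn1 leq_add2l.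
  by apply: leq_trans (dimvS (subvf _)) _; rewrite dimvf.
pose U := (B :&: lker (g u) :&: lker (g v))%VS.
have U0 : vpick U != 0.
  rewrite vpick0 -dimv_eq0 -lt0n -ltnS.
  apply: leq_trans (cap_dim _ (g v)); rewrite -ltnS.
  by apply: leq_trans (cap_dim _ (g u)); rewrite dimB.
have := memv_pick U; rewrite !memv_cap !memv_ker => /andP[/andP[bB /eqP ub] /eqP vb].
by exists (vpick U).
Qed.

(* In terms of the endomorphism M of A represented by Psi, a /\ b acts as the
   commutator with the rank-one map a (x) b.  If b(a) = 0, the double commutator
   is -2 b(M a) a (x) b; such a and b with b(M a) <> 0 exist since M, being
   tracefree and nonzero, is not scalar.  One more rotation changes either factor
   of a nilpotent a (x) b, and for n > 2 any two such maps are linked through a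
   common annihilator. *)
Lemma mixed_vanish_irr (W : {vspace tensor2 V}) : (2 < n)%N ->
    (W <= mixed_vanish A B)%VS -> W <> 0%VS ->
    {in A & B, forall a b, {in W, forall Psi, filt_act g (rot g a b) Psi \in W}} ->
  W = mixed_vanish A B.
Proof.
move=> n_gt2 WS W0 actW; have n_gt0 : (0 < n)%N by apply: ltn_trans n_gt2.
apply/eqP; rewrite eqEsubv WS /=.
have [Psi PW Psi0] : exists2 Psi, Psi \in W & Psi != 0.
  by exists (vpick W); rewrite ?memv_pick // vpick0; apply/eqP.
have [PA PB tr0] := mixed_vanishP _ _ _ (subvP WS _ PW).
have [a aA [b bB [gab Pba]]] :
    exists2 a, a \in A & exists2 b, b \in B & g a b = 0 /\ Psi b a != 0.
  have [/forallP off0|/forallPn[i /forallPn[j]]] :=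
      boolP [forall i, forall j, (i != j) ==> (Psi (f i) (e j) == 0)]; last first.
    rewrite negb_imply eq_sym => /andP[/negPf ne_ji Pij].
    by exists (e j) => //; exists (f i) => //; rewrite gef ne_ji.
  have off i j : i != j -> Psi (f i) (e j) = 0.
    by move=> ij; apply/eqP; move/forallP/(_ j)/implyP: (off0 i); apply.
  pose i0 := Ordinal n_gt0.
  have [/forallP diag0|/forallPn[i diag_i]] :=
      boolP [forall i, Psi (f i) (e i) == Psi (f i0) (e i0)].
    (* A diagonal [Psi] with constant diagonal is scalar; its trace is [n] times that constant, so
       in characteristic zero it vanishes, against the choice of [Psi]. *)
    have diag i : Psi (f i) (e i) = Psi (f i0) (e i0) by apply/eqP/diag0.
    case/eqP: Psi0; apply: frame_eq0 => i j; try (exact: PA); try exact: PB.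
    have [<-|/eqP/off //] := i =P j; rewrite diag; apply/eqP.
    have : tr2 g Psi = n%:R * Psi (f i0) (e i0).
      rewrite tr2_frame (eq_bigr (fun=> Psi (f i0) (e i0))) => [|k _].
        by rewrite sumr_const card_ord mulr_natl.
      by rewrite (PA _ (eA k)) add0r.
    rewrite tr0 => /esym/eqP; rewrite mulf_eq0.
    by have /pcharf0P -> := K0; rewrite eqn0Ngt n_gt0.
  have ne_i : i != i0 by apply: contraNneq diag_i => ->.
  (* These vectors are orthogonal, and with zero off-diagonal entries [Psi] takes on them the
     difference of two distinct diagonal values. *)
  exists (e i + e i0); first by rewrite memvD.
  exists (f i - f i0); first by rewrite memvB.
  rewrite tensor2Dl !tensor2Br !gef !eqxx [i0 == i]eq_sym (negPf ne_i).
  rewrite tensor2Bl !tensor2Dr (off i i0) // (off i0 i); last by rewrite eq_sym.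
  by rewrite subr0 sub0r subrr addr0 add0r subr_eq0.
pose d := sharp g (Psi b); have gd w : g d w = Psi b w by rewrite sharpE.
pose c := sharp g (transp V Psi a).
have gc w : g c w = Psi w a by rewrite sharpE // transpE.
have dB : d \in B by apply: (null_perp hg (null_splittingC AB)) => w wB; rewrite gd PB.
have cA : c \in A by apply: (null_perp hg AB) => w wA; rewrite gc PA.
have abW : formprod g a b \in W.
  have : filt_act g (rot g a b) (filt_act g (rot g a b) Psi) \in W by rewrite !actW.
  have -> : filt_act g (rot g a b) Psi = formprod g a d - formprod g c b.
    apply/tensor2P=> x y; rewrite tensor2_actE !rot_act // tensor2B !formprodE gd gc.
    rewrite !(tensor2Bl, tensor2Br, tensor2Zl, tensor2Zr).
    by rewrite (PA a aA) (PB b bB); ring.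
  have -> : filt_act g (rot g a b) (formprod g a d - formprod g c b) =
      (- (2%:R * Psi b a)) *: formprod g a b.
    apply/tensor2P=> x y; rewrite linearB /= !filt_act_formprod ?rot_skew //.
    rewrite (rot_actA _ aA aA) (rot_actA _ aA cA) (rot_actB _ bB bB).
    rewrite (rot_actB _ bB dB) [g b a]formC // gab [g a d]formC // gd.
    rewrite [g b c]formC // gc.
    rewrite !(tensor2B, tensor2D, tensor2Z, formprodE, tensor2Zl); ring.
  move=> /(memvZ (- (2%:R * Psi b a) : K)^-1); rewrite scalerA mulVf ?scale1r //.
  by rewrite oppr_eq0 mulf_neq0 //; have /pcharf0P -> := K0.
have a0 : a != 0 by apply: contraNneq Pba => ->; rewrite linear0.
have b0 : b != 0 by apply: contraNneq Pba => ->; rewrite linear0 zero_lfunE.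
have changeB a1 b1 b2 : a1 \in A -> b1 \in B -> b2 \in B -> b1 != 0 ->
    g a1 b2 = 0 -> formprod g a1 b1 \in W -> formprod g a1 b2 \in W.
  move=> a1A b1B b2B b10 a1b2 a1b1W.
  (* With [g b1 a2 = 1], the rotation [a2 /\ b2] sends [b1] to [- b2], and it kills [a1] because
     [a1] and [b2] are orthogonal. *)
  have [a2 a2A b1a2] := null_pairing hg (null_splittingC AB) b1B b10.
  have -> : formprod g a1 b2 = - filt_act g (rot g a2 b2) (formprod g a1 b1).
    apply/tensor2P=> x y; rewrite filt_act_formprod ?rot_skew // tensor2N tensor2D.
    rewrite (rot_actA _ a2A a1A) (rot_actB _ b2B b1B).
    rewrite [g b2 a1]formC // a1b2 [g a2 b1]formC // b1a2.
    by rewrite !formprodE !tensor2Zl; ring.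
  by rewrite memvN actW.
have changeA a1 a2 b1 : a1 \in A -> a2 \in A -> b1 \in B -> a1 != 0 ->
    g a2 b1 = 0 -> formprod g a1 b1 \in W -> formprod g a2 b1 \in W.
  move=> a1A a2A b1B a10 a2b1 a1b1W.
  have [b2 b2B a1b2] := null_pairing hg AB a1A a10.
  have -> : formprod g a2 b1 = filt_act g (rot g a2 b2) (formprod g a1 b1).
    apply/tensor2P=> x y; rewrite filt_act_formprod ?rot_skew // tensor2D.
    rewrite (rot_actA _ a2A a1A) (rot_actB _ b2B b1B).
    rewrite [g b2 a1]formC // a1b2 a2b1.
    by rewrite !formprodE !tensor2Zl; ring.
  by rewrite actW.
apply: mixed_vanish_sub => // u v uA vB guv.
(* The common annihilator [b1] of [a] and [u] links the products: from [(a, b)] to [(a, b1)], then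
   [(u, b1)], then [(u, v)], each pair being orthogonal. *)
have [b1 b1B [b10 ab1 ub1]] := null_orthogonal a u n_gt2.
apply: (changeB _ b1) => //; apply: (changeA a) => //.
exact: (changeB _ b).
Qed.

Lemma dim_symm_vanish : (2 * \dim (symm_vanish A))%N = (n * (n + 1))%N.
Proof. by have [-> _] := symm_vanish_basis; apply: card_upper_triangle. Qed.

Lemma dim_mixed_vanish : (0 < n)%N -> \dim (mixed_vanish A B) = (n ^ 2 - 1)%N.
Proof.
by move=> n0; have [-> _] := mixed_vanish_basis (Ordinal n0); apply: card_off_corner.
Qed.

Lemma raise2_symm_vanish : (raise2 g @: symm_vanish A <= tensv A A)%VS.
Proof.
apply/subvP=> _ /memv_imgP[Psi PS ->]; have [_ /(_ _ PS) ->] := symm_vanish_basis.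
rewrite linear_sum memv_suml // => ij _; rewrite linearZ memvZ //.
rewrite linearD memvD /= ?raise2_formprod ?mem_tensv //.
by case: ifP => _; rewrite ?linear0 ?mem0v ?raise2_formprod ?mem_tensv.
Qed.

Lemma raise2_mixed_vanish :
  (0 < n)%N -> (raise2 g @: mixed_vanish A B <= tensv A B)%VS.
Proof.
move=> n0; apply/subvP=> _ /memv_imgP[Psi PS ->].
have [_ /(_ _ PS) ->] := mixed_vanish_basis (Ordinal n0).
rewrite linear_sum memv_suml // => ij _; rewrite linearZ memvZ //.
rewrite linearB memvB /= ?raise2_formprod ?mem_tensv //.
by case: ifP => _; rewrite ?linear0 ?mem0v ?raise2_formprod ?mem_tensv.
Qed.

(** Every term of the frame formula has an argument in [A]. Hence the trace condition is automatic
    in the two extreme degrees. *)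
Lemma tr2_symm_vanish Phi : Phi \in symm_vanish A -> tr2 g Phi = 0.
Proof.
move=> /symm_vanishP[sym PA]; rewrite tr2_frame big1 // => i _.
by rewrite [Phi (f i) _]sym !(PA _ (eA i)) addr0.
Qed.
End Frame.
End Components.

(** * The filtration attached to a pure spinor *)

Section Pull.
Variables (K : fieldType) (V : vectType K).
Implicit Types (Phi : tensor2 V) (P Q : 'End(V)).

(** For projections [P] and [Q] of a splitting, this extracts one block of the form. *)
Definition pull P Q : 'End(tensor2 V) :=
  linfun (fun Phi : tensor2 V => (dualmap Q \o (Phi \o P))%VF : tensor2 V).

Lemma pullE P Q Phi u v : pull P Q Phi u v = Phi (P u) (Q v).
Proof.
have E Psi x y : (dualmap Q \o (Psi \o P))%VF x y = Psi (P x) (Q y).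
  by rewrite 2!comp_lfunE dualmapE.
rewrite linfunE ?E // => k S T; apply/tensor2P=> x y.
by rewrite tensor2_linP !E tensor2_linP.
Qed.

Lemma pull_tensor2_act (X P Q : 'End(V)) Phi :
    (forall v, P (X v) = X (P v)) -> (forall v, Q (X v) = X (Q v)) ->
  pull P Q (tensor2_act X Phi) = tensor2_act X (pull P Q Phi).
Proof.
move=> PX QX; apply/tensor2P=> u v.
by rewrite pullE !tensor2_actE !pullE PX QX.
Qed.
End Pull.

Lemma daddv_pi_comm (K : fieldType) (V : vectType K) (A B : {vspace V})
    (X : 'End(V)) :
    (A + B = fullv)%VS -> (A :&: B = 0)%VS ->
    {in A, forall v, X v \in A} -> {in B, forall v, X v \in B} ->
  forall v, daddv_pi A B (X v) = X (daddv_pi A B v).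
Proof.
move=> sAB cAB XA XB v; have : v \in (A + B)%VS by rewrite sAB memvf.
move=> /memv_addP[a aA [b bB ->]]; rewrite !linearD /=.
rewrite (daddv_pi_id cAB aA) (daddv_pi_id cAB (XA _ aA)).
by rewrite (daddv_pi0 cAB bB) (daddv_pi0 cAB (XB _ bB)) linear0.
Qed.

Section PureSpinor.
Variables (K : fieldType) (V Sp Sm : vectType K) (g : tensor2 V).
Variables (gp : 'Hom(V, 'Hom(Sp, Sm))) (xi : Sp).
Hypothesis hg : nondegenerate_symmetric g.
Hypothesis K0 : [pchar K] =i pred0.

(** If [u] and [v] both annihilate [xi], the Clifford relation applied to [xi] leaves
    [g u v *: xi = 0]. *)
Lemma clifford_null (gm : 'Hom(V, 'Hom(Sm, Sp))) : xi != 0 ->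
    (forall u v s, 2^-1 *: (gm v (gp u s) + gm u (gp v s)) = - (g u v : K) *: s) ->
  totally_null g (V_half gp xi).
Proof.
move=> xi0 cl u v; rewrite !memv_ker !xi_lowE => /eqP gu /eqP gv.
have := cl u v xi; rewrite gu gv !linear0 addr0 scaler0 => /esym/eqP.
by rewrite scaler_eq0 (negPf xi0) orbF oppr_eq0 => /eqP.
Qed.

Variable Vm : {vspace V}.
Let Vp := V_half gp xi.
Hypothesis AB : null_splitting g Vp Vm.
Let BA := null_splittingC AB.
Let sAB : (Vp + Vm = fullv)%VS. Proof. by case: AB. Qed.
Let cAB : (Vp :&: Vm = 0)%VS. Proof. by case: AB. Qed.
Let sBA : (Vm + Vp = fullv)%VS. Proof. by case: BA. Qed.
Let cBA : (Vm :&: Vp = 0)%VS. Proof. by case: BA. Qed.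
Let nA : totally_null g Vp. Proof. by case: AB. Qed.

Lemma xi_upP u : reflect (exists al, u = xi_up g gp xi al) (u \in Vp).
Proof.
apply: (iffP idP) => [uA|[al ->]].
  (* For [u] in the null space [Vp], [g u] vanishes on the kernel of [xi_low] and so factors through
     it; the generalised inverse provides the factor. *)
  exists ((g u \o (xi_low gp xi)^-1)%VF : dual Sm).
  apply: (form_inj hg) => w; rewrite comp_lfunE sharpE // dualmapE comp_lfunE.
  apply/eqP; rewrite -subr_eq0 -tensor2Br; apply/eqP/nA => //.
  by rewrite memv_ker linearB /= limg_lfunVK ?subrr ?memv_img ?memvf.
apply: (null_perp hg AB) => w; rewrite memv_ker => /eqP w0.
by rewrite comp_lfunE sharpE // dualmapE w0 linear0.
Qed.

Local Notation Fil := (filtration g gp xi).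

Lemma filtration0_VpP Phi : reflect
  (Phi \in tracefree_symm2 g /\ {in Vp &, forall u v, Phi u v = 0})
  (Phi \in Fil 0).
Proof.
apply: (iffP (filtration0P _ _ _ _)) => -[tf P0]; split=> //.
  move=> _ _ /xi_upP[al ->] /xi_upP[be ->].
  by rewrite -Pi_m1E P0 !zero_lfunE.
apply/tensor2P=> al be; rewrite Pi_m1E !zero_lfunE P0 //; apply/xi_upP;
  by [exists al | exists be].
Qed.

Lemma filtration1_VpP Phi : reflect
  (Phi \in tracefree_symm2 g /\ {in Vp, forall u v, Phi u v = 0})
  (Phi \in Fil 1).
Proof.
apply: (iffP (filtration1P _ _ _ _)) => -[tf P0]; split=> //.
  by move=> _ /xi_upP[al ->] v; rewrite -Pi_0E P0 !zero_lfunE.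
apply/lfunP=> al; apply/lfunP=> v; rewrite Pi_0E !zero_lfunE P0 //.
by apply/xi_upP; exists al.
Qed.

(** The condition says that [so_act g phi] maps [Vp] into its orthogonal complement, which is [Vp]
    again. *)
Lemma parabolicP phi : phi \in parabolic g gp xi ->
  phi \in skew2 V /\ {in Vp, forall u, so_act g phi u \in Vp}.
Proof.
rewrite memv_cap [X in _ && X]memv_ker linfunE => [|//]; last exact: Pi_m1_linear.
move=> /andP[sk /eqP P0]; split=> // u uA.
apply: (null_perp hg AB) => v vA; rewrite so_actE //.
move/xi_upP: uA => [al ->]; move/xi_upP: vA => [be ->].
by rewrite -Pi_m1E P0 !zero_lfunE.
Qed.

Local Notation g0 := (g_deg g gp xi Vm 0).

Lemma g0P phi : reflect
  [/\ phi \in skew2 V, {in Vp, forall u, so_act g phi u \in Vp}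
    & {in Vm, forall u, so_act g phi u \in Vm}]
  (phi \in g0).
Proof.
rewrite !inE mulr0 !addr0 /V_deg /=.
have subP (U : {vspace V}) :
    reflect {in U, forall u, so_act g phi u \in U} (so_act g phi @: U <= U)%VS.
  apply: (iffP subvP) => [H u uU|H _ /memv_imgP[u uU ->]]; last exact: H.
  by apply: H; apply: memv_img.
by apply: (iffP and3P) => -[? /subP ? /subP ?].
Qed.

Lemma g0_parabolic : {subset g0 <= parabolic g gp xi}.
Proof.
move=> phi /g0P[sk pA _]; rewrite memv_cap sk [X in _ && X]memv_ker.
rewrite linfunE; last exact: Pi_m1_linear.
apply/eqP/tensor2P=> al be; rewrite Pi_m1E !zero_lfunE.
have al_ : xi_up g gp xi al \in Vp by apply/xi_upP; exists al.
have be_ : xi_up g gp xi be \in Vp by apply/xi_upP; exists be.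
by rewrite -(so_actE hg) nA ?pA.
Qed.

Lemma rot_g0 : {in Vp & Vm, forall a b, rot g a b \in g0}.
Proof.
move=> a b aA bB; apply/g0P; split; first exact: rot_skew.
  by move=> u uA; rewrite rot_act // [g a u]nA // scale0r subr0 memvZ.
have [_ nB _ _] := AB.
by move=> u uB; rewrite rot_act // [g b u]nB // scale0r sub0r memvN memvZ.
Qed.

(** The bivectors of [rot_g0] with the opposite sign, for the degree -1 piece, where the two
    summands exchange roles. *)
Lemma rotC_g0 : {in Vm & Vp, forall a b, rot g a b \in g0}.
Proof.
have [_ nB _ _] := AB; move=> b a bB aA; apply/g0P; split; first exact: rot_skew.
  by move=> u uA; rewrite rot_act // [g a u]nA // scale0r sub0r memvN memvZ.
by move=> u uB; rewrite rot_act // [g b u]nB // scale0r subr0 memvZ.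
Qed.

Lemma filtration_sub : [/\ 0%VS = Fil 2, (Fil 2 <= Fil 1)%VS, (Fil 1 <= Fil 0)%VS,
  (Fil 0 <= Fil (-1))%VS & Fil (-1) = tracefree_symm2 g].
Proof.
split=> //.
- exact: sub0v.
- apply/subvP=> Phi /filtration1_VpP[tf P0]; apply/filtration0_VpP; split=> // u v uA _.
  exact: P0.
- exact: capvSl.
Qed.

Lemma submodule_filtration (i : int) : (-1 <= i <= 2)%R ->
  submodule (parabolic g gp xi) (filt_act g) (Fil i).
Proof.
have tf phi Phi : phi \in skew2 V -> Phi \in tracefree_symm2 g ->
    filt_act g phi Phi \in tracefree_symm2 g.
  move=> sk /tracefree_symm2P[/symm2P sym _]; apply/tracefree_symm2P.
  split; last exact: tr2_act.
  apply/symm2P=> u v; rewrite !tensor2_actE addrC.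
  by rewrite [Phi u _]sym [Phi _ v]sym.
move=> i_range; apply/submoduleP=> phi /parabolicP[sk pA] Phi.
have : i \in [:: -1; 0; 1; 2].
  by case: i i_range => [[|[|[|]]]|[|]].
rewrite !inE => /or4P[] /eqP ->.
- exact: tf.
- move/filtration0_VpP=> [Ptf P0]; apply/filtration0_VpP; split; first exact: tf.
  by move=> u v uA vA; rewrite tensor2_actE !P0 ?pA // oppr0 addr0.
- move/filtration1_VpP=> [Ptf P0]; apply/filtration1_VpP; split; first exact: tf.
  by move=> u uA v; rewrite tensor2_actE !P0 ?pA // oppr0 addr0.
by rewrite /filtration /= memv0 => /eqP ->; rewrite linear0 mem0v.
Qed.

(** * Irreducibility and Cartan products of the three graded pieces *)

Definition graded_iso_cartan i (W W' : {vspace V}) :=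
  exists2 Z : {vspace tensprod V V},
    cartan_product g0 (so_act g) W (so_act g) W' Z
  & isomorphic g0 (graded_act g gp xi i) (graded g gp xi i)
      (fun phi => tens_act (so_act g phi) (so_act g phi)) Z.

(** The argument shared by the three degrees: [pull P Q] identifies the quotient with [S], and
    [raise2] carries [S] into the tensor product. Irreducibility is proved over [g0] and passes to
    the parabolic, each of whose submodules is in particular a [g0]-submodule. *)
Lemma graded_component (i : int) (P Q : 'End(V)) (S : {vspace tensor2 V})
    (W W' : {vspace V}) :
    (-1 <= i <= 2)%R -> (-1 <= i + 1 <= 2)%R ->
    (pull P Q @: Fil i = S)%VS -> (Fil i :&: lker (pull P Q) = Fil (i + 1))%VS ->
    {in g0, forall phi v, P (so_act g phi v) = so_act g phi (P v)} ->
    {in g0, forall phi v, Q (so_act g phi v) = so_act g phi (Q v)} ->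
    S <> 0%VS ->
    (forall Y : {vspace tensor2 V}, (Y <= S)%VS -> Y <> 0%VS ->
      submodule g0 (filt_act g) Y -> Y = S) ->
    (raise2 g @: S <= tensv W W')%VS -> (\dim W * \dim W' < 2 * \dim S)%N ->
  [/\ irreducible (parabolic g gp xi) (graded_act g gp xi i) (graded g gp xi i),
      graded_iso_cartan i W W' & \dim (graded g gp xi i) = \dim S].
Proof.
move=> range_i range_i1 imS kerS commP commQ S0 irrS STW ltS.
have sub_g0 j : (-1 <= j <= 2)%R -> submodule g0 (filt_act g) (Fil j).
  by move=> /submodule_filtration aF phi /g0_parabolic; apply: aF.
have pull_act : {in g0, forall phi, {in Fil i, forall Phi,
    pull P Q (filt_act g phi Phi) = filt_act g phi (pull P Q Phi)}}.
  by move=> phi phi0 Phi _; apply: pull_tensor2_act => v; [apply: commP | apply: commQ].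
have isoS : isomorphic g0 (graded_act g gp xi i) (graded g gp xi i) (filt_act g) S.
  by rewrite -imS; apply: isomorphic_subquo => //; apply: sub_g0.
have subgr : submodule (parabolic g gp xi) (graded_act g gp xi i) (graded g gp xi i).
  by apply: submodule_subquo; apply: submodule_filtration.
have subgr0 : submodule g0 (graded_act g gp xi i) (graded g gp xi i).
  by move=> phi /g0_parabolic; apply: subgr.
have subS : submodule g0 (filt_act g) S.
  move/submoduleP: (sub_g0 _ range_i) => aF.
  apply/submoduleP=> phi phi0; rewrite -imS => _ /memv_imgP[Phi PF ->].
  by rewrite -pull_act // memv_img ?aF.
have irr_gr : irreducible g0 (graded_act g gp xi i) (graded g gp xi i).
  apply/(isomorphic_irreducible isoS) => //; split=> // Y YS subY.
  by have [|/eqP Y0] := Y =P 0%VS; [left | right; apply: irrS => //; apply/eqP].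
have isoZ : isomorphic g0 (graded_act g gp xi i) (graded g gp xi i)
    (fun phi => tens_act (so_act g phi) (so_act g phi)) (raise2 g @: S)%VS.
  rewrite -imS -limg_comp; apply: isomorphic_subquo; last first.
  - move=> phi phi0 Phi PF; rewrite !comp_lfunE pull_act // raise2_act //.
    by have /g0P[] := phi0.
  - exact: sub_g0.
  rewrite -kerS; apply/vspaceP=> Phi; rewrite !memv_cap !memv_ker comp_lfunE.
  by rewrite -(inj_eq (raise2_inj hg)) linear0.
split; last exact: isomorphic_dim isoS.
  have [gr0 _ irr] := irr_gr; split=> // Y YX subY; apply: irr => // phi /g0_parabolic.
  exact: subY.
exists (raise2 g @: S)%VS => //; apply: cartan_product_dim => //.
  by apply/(isomorphic_irreducible isoZ).
by rewrite -(isomorphic_dim isoZ) (isomorphic_dim isoS).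
Qed.

Variables (n : nat) (e f : 'I_n -> V).
Hypotheses (ef : null_frame g Vp Vm e f) (n_gt2 : (2 < n)%N).
Hypotheses (dimVp : \dim Vp = n) (dimVm : \dim Vm = n).

Let piVm := daddv_pi Vm Vp.
Let piVp := daddv_pi Vp Vm.

Let piVm_comm : {in g0, forall phi v, piVm (so_act g phi v) = so_act g phi (piVm v)}.
Proof. by move=> phi /g0P[_ pA pB]; apply: daddv_pi_comm. Qed.

Let piVp_comm : {in g0, forall phi v, piVp (so_act g phi v) = so_act g phi (piVp v)}.
Proof. by move=> phi /g0P[_ pA pB]; apply: daddv_pi_comm. Qed.

Lemma symm_vanish_neq0 A B (a b : 'I_n -> V) :
  null_splitting g A B -> null_frame g A B a b -> symm_vanish A <> 0%VS.
Proof.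
move=> sAB_ ab S0; have := dim_symm_vanish sAB_ ab.
rewrite S0 dimv0 muln0 => /esym/eqP.
by rewrite muln_eq0 addn1 orbF -leqn0 leqNgt (ltn_trans _ n_gt2).
Qed.

Lemma symm_vanish_ltn A B (a b : 'I_n -> V) :
  null_splitting g A B -> null_frame g A B a b -> (n * n < 2 * \dim (symm_vanish A))%N.
Proof.
move=> sAB_ ab; rewrite (dim_symm_vanish sAB_ ab) ltn_pmul2l ?addn1 //.
exact: ltn_trans n_gt2.
Qed.

Lemma symm_vanish_tracefree A B (a b : 'I_n -> V) :
    null_splitting g A B -> null_frame g A B a b ->
  (symm_vanish A <= tracefree_symm2 g)%VS.
Proof.
move=> sAB_ ab; apply/subvP=> Phi PS; apply/tracefree_symm2P.
by split; [have := subvP (capvSl _ _) _ PS | apply: (tr2_symm_vanish hg sAB_ ab)].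
Qed.

(** Such a form depends only on the B-components of its arguments. *)
Lemma pull_symm_vanish (A B : {vspace V}) (Phi : tensor2 V) :
    (A + B = fullv)%VS -> (A :&: B = 0)%VS ->
    Phi \in symm_vanish A ->
  pull (daddv_pi B A) (daddv_pi B A) Phi = Phi.
Proof.
move=> sA cA /symm_vanishP[sym PA]; apply/tensor2P=> u v; rewrite pullE.
have dec w : w = daddv_pi A B w + daddv_pi B A w.
  by rewrite daddv_pi_add // sA memvf.
rewrite {2}(dec u) {2}(dec v) tensor2Dl !tensor2Dr.
rewrite !(PA _ (memv_pi A B _)) add0r [Phi _ (daddv_pi A B v)]sym.
by rewrite (PA _ (memv_pi A B v)) !add0r.
Qed.

(** The quotient retains the block on [Vp] x [Vp]; as [g] pairs [Vp] with [Vm], raising indices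
    places it in the symmetric square of [Vm]. *)
Lemma graded_m1 :
  [/\ irreducible (parabolic g gp xi) (graded_act g gp xi (-1)) (graded g gp xi (-1)),
      graded_iso_cartan (-1) Vm Vm
    & \dim (graded g gp xi (-1)) = \dim (symm_vanish Vm)].
Proof.
have fe := null_frameC hg ef.
have [_ _ _ _ Fm1] := filtration_sub.
apply: (@graded_component _ piVp piVp) => //.
- apply/vspaceP=> Phi; rewrite Fm1; apply/memv_imgP/idP => [[Psi Ptf ->]|PS].
    have [/symm2P sym _] := tracefree_symm2P _ _ Ptf.
    apply/symm_vanishP; split=> [u v|u uB v]; rewrite !pullE; first exact: sym.
    by rewrite [piVp u]daddv_pi0 // linear0 zero_lfunE.
  exists Phi; first exact: (subvP (symm_vanish_tracefree BA fe)).
  by rewrite pull_symm_vanish.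
- apply/vspaceP=> Phi; rewrite memv_cap memv_ker Fm1.
  apply/andP/filtration0_VpP => -[tf P0]; split=> //.
    move=> u v uA vA; move/eqP: P0 => /tensor2P/(_ u v).
    by rewrite pullE !daddv_pi_id // !zero_lfunE.
  by apply/eqP/tensor2P=> u v; rewrite pullE !zero_lfunE P0 ?memv_pi.
- exact: symm_vanish_neq0 fe.
- move=> Y YS Y0 /submoduleP subY; apply: (symm_vanish_irr hg K0 BA fe) => //.
  by move=> a b aB bA; apply: subY; apply: rotC_g0.
- exact: (raise2_symm_vanish hg BA fe).
by rewrite dimVm (symm_vanish_ltn BA fe).
Qed.

(** Here the next filtration step is zero and [Fil 1] is already [symm_vanish Vp], on which the
    projection is the identity. *)
Lemma graded_p1 :
  [/\ irreducible (parabolic g gp xi) (graded_act g gp xi 1) (graded g gp xi 1),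
      graded_iso_cartan 1 Vp Vp
    & \dim (graded g gp xi 1) = \dim (symm_vanish Vp)].
Proof.
have F1 : Fil 1 = symm_vanish Vp.
  apply/vspaceP=> Phi; apply/filtration1_VpP/idP => [[tf P0]|PS].
    have [/symm2P sym _] := tracefree_symm2P _ _ tf.
    by apply/symm_vanishP.
  split; first exact: (subvP (symm_vanish_tracefree AB ef)).
  by case/symm_vanishP: PS.
apply: (@graded_component _ piVm piVm) => //.
- apply/vspaceP=> Phi; rewrite F1; apply/memv_imgP/idP => [[Psi PS ->]|PS].
    by rewrite pull_symm_vanish.
  by exists Phi; rewrite ?pull_symm_vanish.
- apply/vspaceP=> Phi; rewrite memv_cap memv_ker F1 [Fil _]/(0%VS) memv0.
  apply/andP/eqP => [[PS]|->]; first by rewrite pull_symm_vanish // => /eqP.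
  by rewrite mem0v linear0.
- exact: symm_vanish_neq0 ef.
- move=> Y YS Y0 /submoduleP subY; apply: (symm_vanish_irr hg K0 AB ef) => //.
  by move=> a b aA bB; apply: subY; apply: rot_g0.
- exact: (raise2_symm_vanish hg AB ef).
by rewrite dimVp (symm_vanish_ltn AB ef).
Qed.

Lemma tr2_transp (Phi : tensor2 V) : tr2 g (transp V Phi) = tr2 g Phi.
Proof.
rewrite !(tr2_frame hg AB ef); apply: eq_bigr => i _.
by rewrite !transpE addrC.
Qed.

Lemma graded_0 :
  [/\ irreducible (parabolic g gp xi) (graded_act g gp xi 0) (graded g gp xi 0),
      graded_iso_cartan 0 Vp Vm & \dim (graded g gp xi 0) = (n ^ 2 - 1)%N].
Proof.
have n_gt0 : (0 < n)%N by apply: ltn_trans n_gt2.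
have dimS := dim_mixed_vanish hg AB ef n_gt0.
(* This amounts to [n ^ 2 < 2 * (n ^ 2 - 1)], the bound needed for the Cartan product; it also shows
   that the space is nonzero. *)
have n2 : (2 < n ^ 2)%N by rewrite -mulnn (leq_trans n_gt2) ?leq_pmulr.
rewrite -dimS.
apply: (@graded_component _ piVm piVp) => //.
- apply/vspaceP=> Phi; apply/memv_imgP/idP => [[Psi /filtration0_VpP[tf P0] ->]|].
    have [/symm2P sym tr0] := tracefree_symm2P _ _ tf.
    apply/mixed_vanishP; split=> [u uA v|v vB u|].
    + by rewrite pullE [piVm u]daddv_pi0 // linear0 zero_lfunE.
    + by rewrite pullE [piVp v]daddv_pi0 // linear0.
    have [eA fB _ _ _] := ef.
    (* By symmetry the two mixed blocks of [Psi] contribute equally to its trace, so the extracted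
       block carries half of it. *)
    apply: (mulfI (x := 2%:R)); first by have /pcharf0P -> := K0.
    rewrite mulr0 -[RHS]tr0 !(tr2_frame hg AB ef) mulr_sumr; apply: eq_bigr => i _.
    rewrite !pullE [piVm (e i)]daddv_pi0 // linear0 zero_lfunE add0r.
    rewrite [piVm _]daddv_pi_id // [piVp _]daddv_pi_id // [Psi (e i) _]sym.
    by rewrite mulr_natl mulr2n.
  (* Symmetrising gives a preimage: the transposed summand vanishes on [Vm] x [Vp], so the
     projection returns [Phi] with no factor 2. *)
  move=> /mixed_vanishP[PA PB tr0]; exists (Phi + transp V Phi).
    apply/filtration0_VpP; split=> [|u v uA vA]; last first.
      by rewrite tensor2D transpE !PA ?addr0.
    apply/tracefree_symm2P; split.
      by apply/symm2P=> u v; rewrite !tensor2D !transpE addrC.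
    rewrite -(linfunE (@tr2_linear _ _ g)) linearD /= !(linfunE (@tr2_linear _ _ g)).
    by rewrite tr2_transp tr0 addr0.
  apply/tensor2P=> u v; rewrite pullE tensor2D transpE.
  rewrite (PA (piVp v)) ?memv_pi // addr0.
  have decA w : w = piVp w + piVm w by rewrite daddv_pi_add // sAB memvf.
  rewrite {1}(decA u) {1}(decA v) tensor2Dl !tensor2Dr.
  by rewrite !(PA (piVp u)) ?memv_pi // (PB (piVm v)) ?memv_pi // !add0r addr0.
- apply/vspaceP=> Phi; rewrite memv_cap memv_ker.
  (* Within [Fil 0] the block on [Vp] x [Vp] is zero, so by symmetry losing the mixed block as well
     means vanishing on [Vp] x [V]. *)
  apply/andP/filtration1_VpP => [[/filtration0_VpP[tf P00] /eqP P0]|[tf P0]]; split=> //.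
  + have [/symm2P sym _] := tracefree_symm2P _ _ tf.
    move=> u uA v; have [a aA [b bB ->]] := splitting_decomp AB v.
    rewrite tensor2Dr P00 // add0r sym.
    move/tensor2P/(_ b u): P0; rewrite pullE !daddv_pi_id //.
    by rewrite !zero_lfunE.
  + by apply/filtration0_VpP; split=> // u v uA _; apply: P0.
  have [/symm2P sym _] := tracefree_symm2P _ _ tf.
  by apply/eqP/tensor2P=> u v; rewrite pullE !zero_lfunE sym P0 ?memv_pi.
- move=> S0; move: n2; have := dimS; rewrite S0 dimv0 => /esym/eqP.
  by rewrite subn_eq0 => le1 /leq_trans/(_ le1).
- move=> Y YS Y0 /submoduleP subY; apply: (mixed_vanish_irr hg K0 AB ef) => //.
  by move=> a b aA bB; apply: subY; apply: rot_g0.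
- exact: (raise2_mixed_vanish hg AB ef).
rewrite dimVp dimVm dimS mulnn mulnBr muln1 ltn_subRL mul2n -addnn ltn_add2r.
exact: n2.
Qed.
End PureSpinor.

Theorem proposition4p1 (R : realType) (m : nat) (hm : (2 < m)%N)
    (V Sp Sm : vectType R[i]) (hV : \dim {:V} = (2 * m)%N)
    (g : tensor2 V) (hg : nondegenerate_symmetric g)
    (e : (2 * m).-tuple V) (he : orthonormal_frame g e)
    (gp : 'Hom(V, 'Hom(Sp, Sm))) (gm : 'Hom(V, 'Hom(Sm, Sp)))
    (hS : chiral_spinors g gp gm 'i%C e)
    (xi : Sp) (hxi : pure_spinor gp xi m)
    (Vm : {vspace V}) (Vm_null : totally_null g Vm)
    (Vm_compl : (V_half gp xi + Vm = fullv)%VS /\ (V_half gp xi :&: Vm = 0)%VS) :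
  let Vp := V_half gp xi in
  let Fil := filtration g gp xi in
  let p := parabolic g gp xi in
  let g0 := g_deg g gp xi Vm 0 in
  (* F_i^0 is isomorphic, over g_0, to the Cartan product of W and W' *)
  let graded_iso_cartan i (W W' : {vspace V}) :=
    exists2 Z : {vspace tensprod V V},
      cartan_product g0 (so_act g) W (so_act g) W' Z
    & isomorphic g0
        (graded_act g gp xi i) (graded g gp xi i)
        (fun phi => tens_act (so_act g phi) (so_act g phi)) Z in
  [/\ [/\ 0%VS = Fil 2, (Fil 2%R <= Fil 1%R)%VS, (Fil 1%R <= Fil 0%R)%VS,
          (Fil 0%R <= Fil (-1)%R)%VS & Fil (-1) = tracefree_symm2 g],
      forall i : int, -1 <= i <= 2 -> submodule p (filt_act g) (Fil i),
      forall i : int, -1 <= i <= 1 ->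
        irreducible p (graded_act g gp xi i) (graded g gp xi i),
      graded_iso_cartan 0 Vp Vm
        /\ \dim (graded g gp xi 0) = (m ^ 2 - 1)%N
    & [/\ graded_iso_cartan 1 Vp Vp, graded_iso_cartan (-1) Vm Vm,
          (2 * \dim (graded g gp xi 1))%N = (m * (m + 1))%N
        & (2 * \dim (graded g gp xi (-1)))%N = (m * (m + 1))%N]].
Proof.
have K0 : [pchar R[i]] =i pred0 by apply: Num.Theory.pchar_num.
have [xi0 dimVp] := hxi; have [sAB cAB] := Vm_compl.
have xi_neq0 : xi != 0 by apply/eqP.
have AB : null_splitting g (V_half gp xi) Vm.
  by split=> //; have [_ cl _ _] := hS; apply: (clifford_null xi_neq0 cl).
have dimVm : \dim Vm = m.
  apply/eqP; rewrite -(eqn_add2l m) -{1}dimVp -(dimv_disjoint_sum cAB) sAB hV.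
  by rewrite mul2n addnn.
have [a [b ab]] := null_frame_exists hg AB dimVp.
move=> Vp Fil p g0 graded_iso.
have [irr1 iso1 dim1] := graded_p1 hg K0 AB ab hm dimVp.
have [irr0 iso0 dim0] := graded_0 hg K0 AB ab hm dimVp dimVm.
have [irrm1 isom1 dimm1] := graded_m1 hg K0 AB ab hm dimVm.
split.
- exact: (filtration_sub hg AB).
- exact: (submodule_filtration hg AB).
- move=> i range_i; have : i \in [:: -1; 0; 1] by case: i range_i => [[|[|]]|[|]].
  rewrite !inE => /or3P[] /eqP ->; [exact: irrm1 | exact: irr0 | exact: irr1].
- exact: conj iso0 dim0.
split; [exact: iso1 | exact: isom1 | |]; first by rewrite dim1 (dim_symm_vanish AB ab).
by rewrite dimm1 (dim_symm_vanish (null_splittingC AB) (null_frameC hg ab)).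
Qed.
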